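(* Let $G$ be an integral hyperelliptic graph of genus $\ge2$ with involution $\iota$, let $G^{\langle\iota\rangle}$ be the set of fixed points of $\iota$, and let $\mathcal{W}$ be the set of those connected components of $G^{\langle\iota\rangle}$ that contain a point of integer distance from a vertex of $G$. Then there are isomorphisms of $\mathrm{Aut}\,G$-modules $$\Phi(G)[2]\cong\begin{cases}0&\text{if }\mathcal{W}=\emptyset\text{ and }\mathrm{rk}\,H_1(G,\mathbb{Z})\text{ is even},\\ \mathbb{F}_2&\text{if }\mathcal{W}=\emptyset\text{ and }\mathrm{rk}\,H_1(G,\mathbb{Z})\text{ is odd},\\ \ker\bigl(\mathbb{F}_2[\mathcal{W}]\xrightarrow{\ \mathrm{sum}\ }\mathbb{F}_2\bigr)&\text{otherwise,}\end{cases}$$ where ''sum'' denotes the sum of the coefficients map.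
   Context: Graphs are finite topological graphs with a chosen vertex set; loops and multiple edges are allowed, a loop counts twice in the degree. Isomorphisms of graphs are homotopy classes of homeomorphisms preserving vertices and edges (equivalently, incidence-preserving bijections of vertices and half-edges; loops may be reversed). A (closed) hyperelliptic graph is a connected graph $G$ with a genus function $g:V(G)\to\mathbb{Z}_{\ge0}$ and a graph isomorphism $\iota:G\to G$ with $\iota^2=1$ such that (1) vertices of non-zero genus are $\iota$-invariant; (2) genus $0$ vertices have degree $\ge3$; (3) $2g(v)+2\ge\#\{\iota\text{-invariant edges at }v\}$ for every vertex $v$ ($\iota$-invariant means fixed pointwise); (4) the topological quotient $G/\langle\iota\rangle$ is a tree. (The paper also admits two exceptional graphs of genus $0$ and $1$, irrelevant here.) Its genus is $\mathrm{rk}\,H_1(G,\mathbb{Z})+\sum_vg(v)$. A metric hyperelliptic graph carries an $\iota$-invariant length function $E(G)\to\mathbb{R}_{>0}$, where $\iota$ acts by an isometry (an edge mapped to itself in reverse is reflected in its midpoint). A hyperelliptic graph of genus $\ge2$ is integral if it is metric and all edge lengths are integers. $\mathrm{Aut}\,G$ is the group of automorphisms preserving vertices, edges, genera, lengths, and commuting with $\iota$. $\Lambda=H_1(G,\mathbb{Z})$ carries the $\mathrm{Aut}\,G$-invariant positive definite pairing induced from $1$-chains by $\langle e,e'\rangle=\mathrm{length}(e)$ if $e=e'$ and $0$ otherwise. For $G$ integral it is $\mathbb{Z}$-valued, and the Tamagawa group is $\Phi(G)=\Lambda^\vee/\Lambda$, where $\Lambda^\vee=\mathrm{Hom}(\Lambda,\mathbb{Z})$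 and $\Lambda\hookrightarrow\Lambda^\vee$ by $x\mapsto\langle x,-\rangle$, with the induced $\mathrm{Aut}\,G$-action. $\Phi(G)[2]$ is its $2$-torsion subgroup. $\mathrm{Aut}\,G$ acts on $\mathbb{F}_2[\mathcal{W}]$ by permuting $\mathcal{W}$. *)

(* Defs.v *)
From HB Require Import structures.
From mathcomp Require Import all_boot all_order all_fingroup all_algebra.
From mathcomp Require Import generic_quotient.
From mathcomp Require Import all_classical all_reals all_analysis.

Set Implicit Arguments.
Unset Strict Implicit.
Unset Printing Implicit Defensive.

Import Order.TTheory GRing.Theory Num.Theory.
Import numFieldNormedType.Exports.

Local Open Scope classical_set_scope.
Local Open Scope ring_scope.
Local Open Scope quotient_scope.

(* Loops and multiple edges are allowed.  Every edge carries a reference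
   orientation, used only as bookkeeping: automorphisms may reverse it. *)
Record graph := Graph {
  vertex : finType;
  edge : finType;
  src : edge -> vertex;
  tgt : edge -> vertex
}.

(* Half-edges, or equivalently oriented edges: (e, false) is e with its
   reference orientation, and (e, true) is e reversed. *)
Definition dart (G : graph) : finType := (edge G * bool)%type.

Definition dflip (G : graph) (d : dart G) : dart G := (d.1, ~~ d.2).
Definition orig (G : graph) (d : dart G) : vertex G :=
  if d.2 then tgt d.1 else src d.1.
Definition dest (G : graph) (d : dart G) : vertex G := orig (dflip d).

(* Each loop at v contributes two darts. *)
Definition degree (G : graph) (v : vertex G) : nat :=
  #|[set d : dart G | orig d == v]%SET|.

Fixpoint walk (G : graph) (u : vertex G) (p : seq (dart G)) (v : vertex G)
    : bool :=
  if p is d :: p' then (orig d == u) && walk (dest d) p' v else u == v.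

Definition graph_connected (G : graph) : Prop :=
  (exists v : vertex G, True) /\
  forall u v : vertex G, exists p : seq (dart G), walk u p v.

(* A simple cycle: a nonempty closed walk without repeated vertices or edges
   (loops and pairs of parallel edges give cycles of length 1 and 2). *)
Definition simple_cycle (G : graph) (c : seq (dart G)) : bool :=
  [&& c != [::], path.cycle (fun d d' => dest d == orig d') c,
      uniq (map (@orig G) c) & uniq (map fst c)].

Definition is_tree (G : graph) : Prop :=
  graph_connected G /\ forall c : seq (dart G), ~~ simple_cycle c.

Definition graph_perm (G : graph) : finGroupType :=
  ({perm vertex G} * {perm dart G})%type.

Definition is_graph_aut (G : graph) (f : graph_perm G) : bool :=
  [forall d : dart G, (orig (f.2 d) == f.1 (orig d)) &&
                      (f.2 (dflip d) == dflip (f.2 d))].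

Definition edge_act (G : graph) (f : graph_perm G) (e : edge G) : edge G :=
  (f.2 (e, false)).1.

Lemma dart_edge_act (G : graph) (f : graph_perm G) (d : dart G) :
  is_graph_aut f -> (f.2 d).1 = edge_act f d.1.
Proof.
case: d => e [] // /forallP/(_ (e, false))/andP[_ /eqP].
by rewrite {1}/dflip /= => ->.
Qed.

(* Barycentric subdivision: the midpoints of edges become vertices, and each
   dart becomes an edge from its origin to the midpoint of its edge.  An
   automorphism acts on it without inverting edges. *)
Definition subdivision (G : graph) : graph :=
  @Graph (vertex G + edge G)%type (dart G)
    (fun d => inl (orig d)) (fun d => inr d.1).

Definition subdivision_vertex_act (G : graph) (f : graph_perm G)
    (x : vertex (subdivision G)) : vertex (subdivision G) :=
  match x with inl v => inl (f.1 v) | inr e => inr (edge_act f e) end.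

(* The type of orbits of f, each orbit being encoded by its canonical
   representative. *)
Definition orbits (X : finType) (f : X -> X) : finType := {x : X | froots f x}.
Definition orbit_of (X : finType) (f : X -> X) (sf : connect_sym (frel f))
  (x : X) : orbits f := exist _ (froot f x) (roots_root sf x).

Lemma subdivision_vertex_act_inj (G : graph) (f : graph_perm G) :
  is_graph_aut f -> injective (subdivision_vertex_act f).
Proof.
move=> af [v|e] [v'|e'] //= [] => [/perm_inj->//|eqe]; congr inr.
have eqd : f.2 (e, false) = f.2 (e', false) \/
           f.2 (e, false) = f.2 (e', true).
  have /forallP/(_ (e', false))/andP[_ /eqP fl] := af.
  move: eqe fl; rewrite /edge_act /dflip /=.
  case: (f.2 (e, false)) => a b; case: (f.2 (e', false)) => a' b' /= -> ->.
  by case: b; case: b'; [left|right|right|left].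
by case: eqd => /perm_inj [].
Qed.

(* The topological quotient of G by the group generated by f, as a graph: the
   quotient of the barycentric subdivision.  Thus an edge reversed by f is
   folded at its midpoint. *)
Definition quotient_graph (G : graph) (f : graph_perm G)
    (af : is_graph_aut f) : graph :=
  @Graph (orbits (@subdivision_vertex_act G f)) (orbits f.2)
    (fun d => orbit_of (fconnect_sym (subdivision_vertex_act_inj af))
                (@src (subdivision G) (val d)))
    (fun d => orbit_of (fconnect_sym (subdivision_vertex_act_inj af))
                (@tgt (subdivision G) (val d))).

Definition chain (G : graph) : zmodType := {ffun edge G -> int}.

Definition boundary (G : graph) (c : chain G) (v : vertex G) : int :=
  \sum_(e : edge G | tgt e == v) c e - \sum_(e : edge G | src e == v) c e.

Definition is_1cycle (G : graph) : {pred chain G} :=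
  fun c => [forall v : vertex G, boundary c v == 0].

Lemma is_1cycle_zmod (G : graph) : zmod_closed (@is_1cycle G).
Proof.
split=> [|c c' /forallP hc /forallP hc']; apply/forallP => v.
  by rewrite /boundary !big1 ?subrr // => e _; rewrite ffunE.
have -> : boundary (c - c') v = boundary c v - boundary c' v.
  rewrite /boundary.
  under eq_bigr do rewrite !ffunE.
  under [X in _ - X = _]eq_bigr do rewrite !ffunE.
  by rewrite !sumrB !opprD !opprK addrACA.
by rewrite (eqP (hc v)) (eqP (hc' v)) subrr.
Qed.

HB.instance Definition _ (G : graph) :=
  GRing.isZmodClosed.Build (chain G) (@is_1cycle G) (@is_1cycle_zmod G).

Record H1 (G : graph) := MkH1 {
  H1_chain :> chain G;
  _ : H1_chain \in @is_1cycle G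
}.
HB.instance Definition _ (G : graph) := [isSub for @H1_chain G].
HB.instance Definition _ (G : graph) := [Choice of H1 G by <:].
HB.instance Definition _ (G : graph) := [SubChoice_isSubZmodule of H1 G by <:].

Definition dart_coef (G : graph) (c : chain G) (d : dart G) : int :=
  (-1) ^+ d.2 * c d.1.

(* Push-forward of chains: the coefficient of f_* c along d is that of c along
   the preimage of d. *)
Definition chain_act (G : graph) (f : graph_perm G) (c : chain G) : chain G :=
  [ffun e => dart_coef c ((f^-1)%g.2 (e, false))].

(* For a free abelian group M of finite rank, its rank. *)
Definition is_Zbasis (M : zmodType) (n : nat) (b : 'I_n -> M) : Prop :=
  bijective (fun a : {ffun 'I_n -> int} => \sum_(i < n) b i *~ a i).
Definition Zrank (M : zmodType) : nat :=
  xget 0%N [set n | exists b : 'I_n -> M, is_Zbasis b].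

(* Edges at v fixed pointwise by f; an edge reversed by f is not one. *)
Definition invariant_edges_at (G : graph) (f : graph_perm G) (v : vertex G) :=
  [set e : edge G | ((src e == v) || (tgt e == v)) &&
                    (f.2 (e, false) == (e, false))]%SET.

Record hyperelliptic_graph := HyperellipticGraph {
  hgraph :> graph;
  vgenus : vertex hgraph -> nat;
  iota : graph_perm hgraph;
  iota_aut : is_graph_aut iota;
  hgraph_connected : graph_connected hgraph;
  iota_invol : (iota * iota = 1)%g;
  vgenus_invariant : forall v, vgenus v != 0%N -> iota.1 v = v;
  vgenus0_degree : forall v, vgenus v = 0%N -> (3 <= degree v)%N;
  invariant_edges_bound :
    forall v, (#|invariant_edges_at iota v| <= 2 * vgenus v + 2)%N;
  quotient_tree : is_tree (quotient_graph iota_aut)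
}.

Definition genus (G : hyperelliptic_graph) : nat :=
  (Zrank (H1 G) + \sum_(v : vertex G) vgenus v)%N.

Record metric_hyperelliptic_graph (R : realType) := MetricHyperellipticGraph {
  mhgraph :> hyperelliptic_graph;
  edge_length : edge mhgraph -> R;
  length_gt0 : forall e, 0 < edge_length e;
  length_iota : forall e, edge_length (edge_act (iota mhgraph) e) = edge_length e
}.

Definition integral_hyperelliptic (R : realType) (G : metric_hyperelliptic_graph R) : Prop :=
  (2 <= genus G)%N /\ forall e : edge G, edge_length e \is a Num.int.

Definition AutG (R : realType) (G : metric_hyperelliptic_graph R)
    : {set graph_perm G} :=
  [set f : graph_perm G |
    [&& is_graph_aut f,
        [forall v, vgenus (f.1 v) == vgenus v],
        [forall e, edge_length (edge_act f e) == edge_length e] &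
        (f * iota G == iota G * f)%g]]%SET.

Lemma graph_aut1 (G : graph) : is_graph_aut (1%g : graph_perm G).
Proof. by apply/forallP => d; rewrite !perm1 !eqxx. Qed.

Lemma graph_autM (G : graph) (f g : graph_perm G) :
  is_graph_aut f -> is_graph_aut g -> is_graph_aut (f * g)%g.
Proof.
move=> /forallP hf /forallP hg; apply/forallP => d.
have /andP[/eqP f1 /eqP f2] := hf d; have /andP[/eqP g1 /eqP g2] := hg (f.2 d).
by rewrite !permM g1 f1 f2 g2 !eqxx.
Qed.

Lemma edge_actM (G : graph) (f g : graph_perm G) (e : edge G) :
  is_graph_aut g -> edge_act (f * g)%g e = edge_act g (edge_act f e).
Proof. by move=> ag; rewrite {1}/edge_act permM (dart_edge_act _ ag). Qed.

Lemma AutG_group_set (R : realType) (G : metric_hyperelliptic_graph R) :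
  group_set (AutG G).
Proof.
apply/group_setP; split=> [|f g].
  rewrite inE graph_aut1 mulg1 mul1g eqxx andbT /=.
  apply/andP; split; apply/forallP => x; first by rewrite perm1.
  by rewrite /edge_act perm1.
rewrite !inE => /and4P[af /forallP gf /forallP lf /eqP cf].
move=> /and4P[ag /forallP gg /forallP lg /eqP cg].
rewrite graph_autM //= -mulgA cg !mulgA cf eqxx andbT.
apply/andP; split; apply/forallP => x.
  by rewrite permM (eqP (gg _)) (eqP (gf _)).
by rewrite edge_actM // (eqP (lg _)) (eqP (lf _)).
Qed.
Canonical AutG_group (R : realType) (G : metric_hyperelliptic_graph R)
  : {group graph_perm G} := Group (AutG_group_set G).

(* Products of permutations apply the left factor first, so g |-> (action of g)
   reverses products, for every action below. *)
Definition hAut (R : realType) (G : metric_hyperelliptic_graph R)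
  : finGroupType := subg_of (AutG_group G).

Lemma hAut_graph_aut (R : realType) (G : metric_hyperelliptic_graph R)
  (g : hAut G) : is_graph_aut (sgval g).
Proof. by have := subgP g; rewrite inE => /and4P[]. Qed.

Section HomologyAction.
Variables (G : graph) (f : graph_perm G).
Hypothesis af : is_graph_aut f.

Lemma graph_autV : is_graph_aut (f^-1)%g.
Proof.
apply/forallP => d; have /andP[/eqP o1 /eqP o2] := forallP af ((f^-1)%g.2 d).
apply/andP; split; apply/eqP.
  by apply: (@perm_inj _ f.1); rewrite -o1 !permKV.
by apply: (@perm_inj _ f.2); rewrite o2 !permKV.
Qed.

Lemma boundary_dart (c : chain G) v :
  boundary c v = - \sum_(d : dart G | orig d == v) dart_coef c d.
Proof.
have -> : \sum_(d : dart G | orig d == v) dart_coef c d =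
    \sum_(e : edge G) \sum_(b : bool)
      (if orig (e, b) == v then dart_coef c (e, b) else 0).
  by rewrite pair_bigA big_mkcond; apply: eq_bigr => -[].
rewrite /boundary big_mkcond [X in _ - X]big_mkcond -sumrB -sumrN.
apply: eq_bigr => e _.
rewrite big_bool /orig /dart_coef /= expr1 expr0 mulN1r mul1r opprD.
by case: ifP; case: ifP; rewrite ?oppr0 ?opprK ?addr0 ?add0r.
Qed.

Lemma dart_coef_act (c : chain G) d :
  dart_coef (chain_act f c) d = dart_coef c ((f^-1)%g.2 d).
Proof.
case: d => e []; rewrite /dart_coef ffunE /dart_coef /= ?mul1r //.
have /forallP/(_ (e, false))/andP[_ /eqP] := graph_autV.
rewrite {1}/dflip /= => ->; rewrite expr1 mulN1r -mulNr.
by case: ((f^-1)%g.2 _) => e' []; rewrite /= ?expr1 ?expr0 ?opprK.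
Qed.

Lemma chain_act_1cycle (c : chain G) :
  c \in @is_1cycle G -> chain_act f c \in @is_1cycle G.
Proof.
move=> /forallP hc; apply/forallP => v; have := hc ((f^-1)%g.1 v).
rewrite !boundary_dart !oppr_eq0 => /eqP hv; apply/eqP; rewrite -[RHS]hv.
rewrite (reindex_inj (@perm_inj _ f.2)) /=; apply: eq_big => d.
  have /forallP/(_ d)/andP[/eqP -> _] := af.
  by apply/eqP/eqP => [<-|->]; rewrite ?permK ?permKV.
by rewrite dart_coef_act permK.
Qed.

Definition H1_act (x : H1 G) : H1 G :=
  MkH1 (chain_act_1cycle (valP x)).

Lemma H1_actD : {morph H1_act : x y / x + y}.
Proof.
move=> x y; apply: val_inj; apply/ffunP => e.
by rewrite !ffunE /dart_coef !ffunE mulrDr.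
Qed.
End HomologyAction.

Definition is_functional (G : graph) : {pred H1 G -> int} :=
  fun f => `[< {morph f : x y / x + y} >].

Lemma is_functional_zmod (G : graph) : zmod_closed (@is_functional G).
Proof.
split=> [|f g /asboolP hf /asboolP hg]; apply/asboolP => x y.
  by rewrite addr0.
by rewrite !fctE hf hg opprD addrACA.
Qed.
HB.instance Definition _ (G : graph) :=
  GRing.isZmodClosed.Build (H1 G -> int) (@is_functional G)
    (@is_functional_zmod G).

Record H1dual (G : graph) := MkH1dual {
  H1dual_fun :> H1 G -> int;
  _ : H1dual_fun \in @is_functional G
}.
HB.instance Definition _ (G : graph) := [isSub for @H1dual_fun G].
HB.instance Definition _ (G : graph) := [Choice of H1dual G by <:].
HB.instance Definition _ (G : graph) :=
  [SubChoice_isSubZmodule of H1dual G by <:].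

Section Tamagawa.
Variables (R : realType) (G : metric_hyperelliptic_graph R).

Definition pairing (c c' : chain G) : R :=
  \sum_(e : edge G) edge_length e * (c e)%:~R * (c' e)%:~R.

(* The image of H1 G in its dual under x |-> <x, ->. *)
Definition in_H1_image : {pred H1dual G} :=
  fun f => `[< exists x : H1 G, forall y : H1 G, (f y)%:~R = pairing x y >].

Lemma in_H1_image_zmod : zmod_closed in_H1_image.
Proof.
split=> [|f g /asboolP[x hx] /asboolP[y hy]]; apply/asboolP.
  by exists 0 => y; rewrite /pairing big1 // => e _; rewrite ffunE mulr0 mul0r.
exists (x - y) => z.
have -> : (f - g) z = f z - g z by [].
rewrite rmorphB /= hx hy /pairing -sumrB; apply: eq_bigr => e _.
by rewrite !ffunE rmorphB /= mulrBr mulrBl.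
Qed.
HB.instance Definition _ :=
  GRing.isZmodClosed.Build (H1dual G) in_H1_image in_H1_image_zmod.

Definition Tamagawa : zmodType := {ideal_quot in_H1_image}.

Definition Tamagawa2 : set Tamagawa := [set x | x *+ 2 = 0].

Lemma H1dual_act_subproof (g : hAut G) (f : H1dual G) :
  (fun x : H1 G => f (H1_act (hAut_graph_aut (g^-1)%g) x))
    \in @is_functional G.
Proof.
apply/asboolP => x y; rewrite H1_actD.
by have /asboolP -> := valP f.
Qed.
Definition H1dual_act (g : hAut G) (f : H1dual G) : H1dual G :=
  MkH1dual (H1dual_act_subproof g f).

Definition Tamagawa_act (g : hAut G) (x : Tamagawa) : Tamagawa :=
  \pi_{ideal_quot in_H1_image} (H1dual_act g (repr x)).

End Tamagawa.

Section Realization.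
Variables (R : realType) (G : graph).

(* The realization is glued from a point for each vertex and a copy of [0, 1]
   for each edge, running from its source (at 0) to its target (at 1). *)
Definition cell (i : vertex G + edge G) : set R :=
  match i with inl _ => [set 0] | inr _ => `[0, 1]%classic end.

Definition cells : topologicalType :=
  {i : (vertex G + edge G)%type & (set_type (cell i) : topologicalType)}.

Definition cell_vertex (p : cells) : option (vertex G) :=
  match projT1 p with
  | inl v => Some v
  | inr e => if \val (projT2 p) == 0 then Some (src e)
             else if \val (projT2 p) == 1 then Some (tgt e) else None
  end.

Definition glued (p q : cells) : bool :=
  (p == q) || (cell_vertex p != None) && (cell_vertex p == cell_vertex q).

Lemma glued_refl : reflexive glued.
Proof. by move=> p; rewrite /glued eqxx. Qed.
Lemma glued_sym : symmetric glued.
Proof.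
move=> p q; rewrite /glued (eq_sym p) (eq_sym (cell_vertex p) (cell_vertex q)).
by case: (cell_vertex q =P cell_vertex p) => [->|_]; rewrite ?andbF.
Qed.
Lemma glued_trans : transitive glued.
Proof.
move=> q p r /orP[/eqP->//|/andP[np /eqP pq]] /orP[/eqP<-|/andP[nq /eqP qr]].
  by rewrite /glued np pq eqxx orbT.
by rewrite /glued np pq qr eqxx orbT.
Qed.
Canonical glued_equiv := EquivRel glued glued_refl glued_sym glued_trans.

Definition realization : topologicalType :=
  quotient_topology {eq_quot glued}.

Lemma cell0 (v : vertex G) : (0 : R) \in cell (inl v).
Proof. by rewrite inE. Qed.

Definition vertex_point (v : vertex G) : realization :=
  \pi_{eq_quot glued} (existT _ (inl v) (exist _ 0 (cell0 v)) : cells).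
Definition edge_point (e : edge G) (s : `[0, 1]%classic : set R) : realization :=
  \pi_{eq_quot glued} (existT _ (inr e) s : cells).

Lemma flip_subproof (s : `[0, 1]%classic : set R) :
  1 - \val s \in (`[0, 1]%classic : set R).
Proof.
have := valP s; rewrite !inE /= !in_itv /= => /andP[s0 s1].
by rewrite subr_ge0 s1 lerBlDr lerDl s0.
Qed.
Definition flip (s : `[0, 1]%classic : set R) : (`[0, 1]%classic : set R) :=
  exist _ (1 - \val s) (flip_subproof s).

(* The homeomorphism induced by an automorphism, affine on edges; an edge
   mapped to itself in reverse is reflected in its midpoint. *)
Definition cells_act (f : graph_perm G) (p : cells) : cells :=
  match p with
  | existT (inl v) s => existT _ (inl (f.1 v)) s
  | existT (inr e) s =>
      existT _ (inr (edge_act f e)) (if (f.2 (e, false)).2 then flip s else s)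
  end.
Definition realization_act (f : graph_perm G) (x : realization) : realization :=
  \pi_{eq_quot glued} (cells_act f (repr x)).

Definition fixed_points (f : graph_perm G) : set realization :=
  [set x | realization_act f x = x].

End Realization.

Section IntegralComponents.
Variables (R : realType) (G : metric_hyperelliptic_graph R).

(* From x one reaches the vertex u after length l without meeting another
   vertex on the way. *)
Definition segment_to (x : realization R G) (u : vertex G) (l : R) : Prop :=
  (x = vertex_point R u /\ l = 0) \/
  exists e : edge G, exists s : (`[0, 1]%classic : set R),
    x = edge_point e s /\
    ((u = src e /\ l = \val s * edge_length e) \/
     (u = tgt e /\ l = (1 - \val s) * edge_length e)).

Definition path_lengths (x : realization R G) (v : vertex G) : set R :=
  [set L | exists u l p, [/\ segment_to x u l, walk u p v &
                             L = l + \sum_(d <- p) edge_length d.1]].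

Definition vertex_dist (x : realization R G) (v : vertex G) : R :=
  inf (path_lengths x v).

Definition integral_comps : set (set (realization R G)) :=
  [set C | (exists2 x, fixed_points (iota G) x &
              C = connected_component (fixed_points (iota G)) x) /\
           (exists2 y, C y & exists v : vertex G, vertex_dist y v \is a Num.int)].

(* F_2[W] is realized inside the F_2-valued functions on sets of points, as
   those finitely supported in integral_comps. *)
Definition F2_fun : zmodType := set (realization R G) -> 'F_2.

Definition F2W : set F2_fun :=
  [set a | finite_set [set C | a C != 0] /\
           [set C | a C != 0] `<=` integral_comps].

Definition F2W_sum (a : F2_fun) : 'F_2 := \sum_(C \in integral_comps) a C.

Definition F2W_sum_ker : set F2_fun := F2W `&` [set a | F2W_sum a = 0].

(* The linear extension of C |-> g(C). *)
Definition F2_fun_act (g : hAut G) (a : F2_fun) : F2_fun :=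
  fun C => a (realization_act (sgval g^-1%g) @` C).

End IntegralComponents.

(* Two subgroups A and B of abelian groups M and N, stable under given actions
   of a group K, are isomorphic as K-modules. *)
Definition module_iso (K : Type) (M N : zmodType)
    (A : set M) (actM : K -> M -> M) (B : set N) (actN : K -> N -> N) : Prop :=
  exists theta : M -> N,
    [/\ set_bij A B theta,
        {in A &, {morph theta : x y / x + y}} &
        forall g, {in A, {morph theta : x / actM g x >-> actN g x}}].

Definition trivial_act (K : Type) (N : zmodType) (g : K) (x : N) : N := x.

Arguments integral_comps {R} G.
Arguments Tamagawa2 {R} G.
Arguments Tamagawa_act {R} G.
Arguments F2W_sum_ker {R} G.
Arguments F2_fun_act {R} G.

(* Main.v *)
Require Import Defs.
From HB Require Import structures.
From mathcomp Require Import all_boot all_order all_fingroup all_algebra.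
From mathcomp Require Import generic_quotient.
From mathcomp Require Import all_classical all_reals all_analysis.
From mathcomp Require Import ring lra.

Set Implicit Arguments.
Unset Strict Implicit.
Unset Printing Implicit Defensive.

Import Order.TTheory GRing.Theory Num.Theory.
Import numFieldNormedType.Exports.

Local Open Scope classical_set_scope.
Local Open Scope ring_scope.
Local Open Scope quotient_scope.

(** Write i for the involution and H for the first homology.  As G / i is a tree,
    i acts on H as -1 ([iota_cycle]); so a cycle vanishes on the edges fixed
    pointwise, and modulo two it is the transfer of a chain on the tree, with
    the fixed edges contracted.  A chain on a tree is determined by its
    boundary.  This boundary vanishes at the vertices exchanged by i, so it is a
    function of sum zero from the set P of components of the fixed locus to F_2,
    and

      H / 2 H is isomorphic to the kernel of the sum map F_2[P] -> F_2.

    Injectivity ([component_boundary_eq0]): if a coefficient along an edge is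
    odd, cutting the tree at that edge gives a union of components on which the
    boundary has odd sum ([separating_set], [odd_edge_cut]).  Surjectivity
    ([cycle_between]): given two components, take a walk in G from one to the
    other, subtract its image under i, and complete the result by half-edges if
    the components are midpoints of edges reversed by i.  In particular the rank
    of H is |P| - 1 ([Zrank_components]).

    Halving identifies the 2-torsion of the Tamagawa group with the radical of
    the pairing on H / 2 H: a class phi with 2 phi = <x, - > goes to x
    ([halves_to]).  Modulo two, exchanged edges contribute twice to the pairing
    and fixed edges not at all, so that only edges reversed by i and of odd length
    matter.  Their midpoints are exactly the components that are not in W
    ([integral_comps_cell]), and the pairing becomes the sum of x_p y_p over the
    components p outside W ([int_pairing_mod2]).  The radical is then the set of
    x of sum zero that vanish outside W if W is nonempty, and of constant x of sum
    zero if W is empty ([half_of_compare]); in the latter case it has order two or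
    one according to whether |P| is even or odd.

    The components of the fixed locus are determined by interpolating functions on
    the cells linearly along the half-edges: this gives continuous functions on the
    realization which separate the components ([interpolate_component]). *)

(** * Sums over the orbits of an involution in characteristic two *)

Lemma F2_addrr (x : 'F_2) : x + x = 0.
Proof. exact: (addrr_pchar2 (pchar_Fp (isT : prime 2))). Qed.

Lemma F2_oppr (x : 'F_2) : - x = x.
Proof. exact: (oppr_pchar2 (pchar_Fp (isT : prime 2))). Qed.

Lemma F2_cases (x : 'F_2) : x = 0 \/ x = 1.
Proof.
by case: x => -[|[|[|m]]] // lt2; [left|right]; apply: val_inj.
Qed.

(** In characteristic two only the fixed points of an involution contribute to an
    invariant sum. *)
Lemma sum_involution (T : finType) (A : pred T) (tau : T -> T) (h : T -> 'F_2) :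
    involutive tau -> (forall a, A (tau a) = A a) ->
    (forall a, A a -> h (tau a) = h a) ->
  \sum_(a | A a) h a = \sum_(a | A a && (tau a == a)) h a.
Proof.
move=> tauK tauA tauh; rewrite (bigID (fun a => tau a == a)) /=.
rewrite [X in _ + X](_ : _ = 0) ?addr0 //.
rewrite (bigID (fun a => enum_rank a < enum_rank (tau a))%N) /=.
rewrite (reindex_inj (inv_inj tauK)) /=.
rewrite [X in X + _](eq_big (fun a => A a && (tau a != a) &&
  ~~ (enum_rank a < enum_rank (tau a))%N) h) ?F2_addrr //.
  move=> a; rewrite tauA tauK; case: (A a) => //=.
  rewrite eq_sym; case: eqVneq => //= na; rewrite -leqNgt ltn_neqAle.
  by rewrite (inj_eq val_inj) (inj_eq enum_rank_inj) na.
by move=> a; rewrite tauA => /andP[/andP[/tauh]].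
Qed.

(** * Separating the ends of an edge of a tree *)

Lemma dflipK (G : graph) : involutive (@dflip G).
Proof. by case=> e b; rewrite /dflip /= negbK. Qed.

(** An edge of a walk has both its ends among the vertices visited. *)
Lemma walk_edge_ends (H : graph) (u : vertex H) (c : seq (dart H)) v d :
  walk u c v -> d.1 \in map fst c ->
  orig d \in u :: map (@dest H) c /\ dest d \in u :: map (@dest H) c.
Proof.
elim: c u => [|d' c IH] u //= /andP[/eqP ou wc]; rewrite inE => /orP[/eqP dd'|].
  have: d = d' \/ d = dflip d'.
    case: d d' dd' {IH ou wc} => e b [e' b'] /= ->; rewrite /dflip /=.
    by case: b; case: b'; auto.
  rewrite !inE -ou => -[] ->.
    by rewrite !eqxx orbT.
  by rewrite /dest dflipK !eqxx orbT.
by move=> /(IH _ wc) [H1 H2]; split; rewrite inE ?H1 ?H2 orbT.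
Qed.

(** A walk without repeated vertices from the end of a dart to its origin,
    avoiding its edge, closes up to a simple cycle. *)
Lemma simple_walk_cycle (H : graph) (c : seq (dart H)) (D : dart H) :
    walk (dest D) c (orig D) -> uniq (dest D :: map (@dest H) c) ->
    all (fun d : dart H => d.1 != D.1) c ->
  simple_cycle (D :: c).
Proof.
have walk_path : forall (c : seq (dart H)) (d : dart H) w, walk (dest d) c w ->
    path.path (fun d d' : dart H => dest d == orig d') d c /\
    w = dest (last d c).
  elim=> [|d' c' IH] d w /= => [/eqP <- //|/andP[/eqP -> /IH[-> ->]]].
  by rewrite eqxx.
have walk_uniq : forall (c : seq (dart H)) u w, walk u c w ->
    uniq (u :: map (@dest H) c) -> uniq (map fst c).
  elim=> [|d' c' IH] u w //= /andP[/eqP ou wc] /and3P[uc dc uc'].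
  rewrite (IH _ _ wc) ?andbT /= ?dc //.
  apply/negP => /(walk_edge_ends wc) [od _].
  by move: uc; rewrite -ou -/(map _ (d' :: c')) /= od.
have walk_orig : forall (c : seq (dart H)) u w, walk u c w ->
    rcons (map (@orig H) c) w = u :: map (@dest H) c.
  elim=> [|d' c' IH] u w /= => [/eqP -> //|/andP[/eqP <- /IH ->]] //.
move=> wc uc ac; have [pc wE] := walk_path _ _ _ wc.
rewrite /simple_cycle /= rcons_path pc -wE eqxx /=.
have := uc; rewrite -(walk_orig _ _ _ wc) rcons_uniq => -> /=.
rewrite (walk_uniq _ _ _ wc uc) andbT; apply/mapP => -[d dc dD].
by have := allP ac _ dc; rewrite dD eqxx.
Qed.

Section TreeCut.
Variables (Q : graph) (Qt : forall c : seq (dart Q), ~~ simple_cycle c).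
Variable D : dart Q.

(** Adjacency after deleting the edge of D. *)
Definition off_edge (a b : vertex Q) : bool :=
  [exists d : dart Q, [&& d.1 != D.1, orig d == a & dest d == b]].

Lemma off_edge_walk (a : vertex Q) (p : seq (vertex Q)) : path.path off_edge a p ->
  exists c : seq (dart Q), [/\ walk a c (last a p), map (@dest Q) c = p &
    all (fun d : dart Q => d.1 != D.1) c].
Proof.
elim: p a => [|b p IH] a /=; first by exists [::]; rewrite /= eqxx.
move=> /andP[/existsP[d /and3P[dD /eqP od /eqP dd]] /IH[c [wc mc ac]]].
by exists (d :: c); rewrite /= od eqxx dd wc mc dD ac.
Qed.

(** In a graph without simple cycles the two ends of an edge are separated by
    deleting that edge. *)
Lemma tree_cut : ~~ connect off_edge (dest D) (orig D).
Proof.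
apply/negP => /connectP[p pp]; case/shortenP: pp => p' pp' up' _ oD.
have [c [wc mc ac]] := off_edge_walk pp'.
have /negP := Qt (D :: c); apply; apply: simple_walk_cycle; rewrite ?mc //.
by rewrite oD.
Qed.

Lemma off_edge_sym : connect_sym off_edge.
Proof.
apply: sym_connect_sym => a b; apply/existsP/existsP => -[d /and3P[dD oa ob]].
  by exists (dflip d); rewrite /dest dflipK ob dD oa.
by exists (dflip d); rewrite /dest dflipK ob dD oa.
Qed.

End TreeCut.

(** * The action of the involution on cells *)

Lemma aut_orig (G : graph) (f : graph_perm G) (d : dart G) :
  is_graph_aut f -> orig (f.2 d) = f.1 (orig d).
Proof. by move=> /forallP/(_ d)/andP[/eqP]. Qed.

Lemma aut_dflip (G : graph) (f : graph_perm G) (d : dart G) :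
  is_graph_aut f -> f.2 (dflip d) = dflip (f.2 d).
Proof. by move=> /forallP/(_ d)/andP[_ /eqP]. Qed.

Section HyperellipticInvolution.
Variable G : hyperelliptic_graph.
Local Notation i := (Defs.iota G).
Implicit Types (d : dart G) (e : edge G) (v : vertex G).

(** The cells of G: its vertices and its edges, an edge standing for its
    midpoint. *)
Local Notation cellT := (vertex G + edge G)%type.

Lemma iota_dartK : involutive i.2.
Proof.
have := congr1 snd (iota_invol G) => /= /permP ii d.
by have := ii d; rewrite permM perm1.
Qed.

Lemma iota_vertexK : involutive i.1.
Proof.
have := congr1 fst (iota_invol G) => /= /permP ii v.
by have := ii v; rewrite permM perm1.
Qed.

Lemma iotaV : (i^-1)%g = i.
Proof. by apply: (mulgI i); rewrite mulgV; exact: esym (iota_invol G). Qed.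

Lemma iota_orig d : orig (i.2 d) = i.1 (orig d).
Proof. exact: aut_orig (iota_aut G). Qed.

Lemma iota_dflip d : i.2 (dflip d) = dflip (i.2 d).
Proof. exact: aut_dflip (iota_aut G). Qed.

Lemma iota_edge d : (i.2 d).1 = edge_act i d.1.
Proof. exact: dart_edge_act (iota_aut G). Qed.

Lemma iota_edgeK : involutive (edge_act i).
Proof. by move=> e; rewrite {2}/edge_act -iota_edge iota_dartK. Qed.

(** Edges mapped to themselves by the involution: pointwise for the first kind,
    in reverse for the second. *)
Definition fixed_edge e := i.2 (e, false) == (e, false).
Definition flipped_edge e := i.2 (e, false) == (e, true).

Lemma flipped_edge_dart e b : flipped_edge e -> i.2 (e, b) = (e, ~~ b).
Proof.
move=> /eqP fe; case: b => //.
by rewrite -[(e, true)]/(dflip (e, false)) iota_dflip fe.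
Qed.

Lemma iota_edge_fixed e : (edge_act i e == e) = fixed_edge e || flipped_edge e.
Proof.
rewrite /fixed_edge /flipped_edge /edge_act; case: (i.2 _) => e' b /=.
by rewrite !xpair_eqE /=; case: b; rewrite ?andbF ?andbT ?orbF.
Qed.

Lemma fixed_dart_edge d : (i.2 d == d) = fixed_edge d.1.
Proof.
case: d => e [] //=.
by rewrite -[(e, true)]/(dflip (e, false)) iota_dflip (inj_eq (inv_inj (@dflipK G))).
Qed.

Lemma fixed_flipped e : fixed_edge e -> flipped_edge e = false.
Proof. by rewrite /flipped_edge => /eqP ->; rewrite xpair_eqE andbF. Qed.

Lemma fixed_edge_orig d : fixed_edge d.1 -> i.1 (orig d) = orig d.
Proof. by rewrite -fixed_dart_edge -iota_orig => /eqP ->. Qed.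

Lemma flipped_edge_tgt e : flipped_edge e -> i.1 (src e) = tgt e.
Proof. by move=> /eqP fe; rewrite -[src e]/(orig (e, false)) -iota_orig fe. Qed.

(** The action of the involution on the cells. *)
Definition iota_cell : cellT -> cellT := @subdivision_vertex_act G i.

(** * Separating sets of cells and the action on homology *)

Lemma fconnect_involution (T : finType) (f : T -> T) (x y : T) :
  involutive f -> fconnect f x y -> y = x \/ y = f x.
Proof.
move=> fK /iter_findex <-; elim: (findex f x y) => [|n IH] /=; first by left.
by case: IH => ->; [right | left].
Qed.

Local Notation Q := (quotient_graph (iota_aut G)).
Local Notation dart_orbit := (orbit_of (fconnect_sym (@perm_inj _ i.2))).
Local Notation cell_orbit :=
  (orbit_of (fconnect_sym (subdivision_vertex_act_inj (iota_aut G)))).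

Lemma dart_orbit_val d : val (dart_orbit d) = d \/ val (dart_orbit d) = i.2 d.
Proof. exact: fconnect_involution iota_dartK (connect_root _ _). Qed.

Lemma cell_orbit_iota z : cell_orbit (iota_cell z) = cell_orbit z.
Proof.
apply: val_inj => /=; apply/esym/eqP.
rewrite root_connect; first exact: fconnect1.
exact: fconnect_sym (subdivision_vertex_act_inj (iota_aut G)).
Qed.

Lemma quotient_src d : src (dart_orbit d : edge Q) = cell_orbit (inl (orig d)).
Proof.
rewrite /src /=; case: (dart_orbit_val d) => /= -> //.
by rewrite iota_orig -[RHS]cell_orbit_iota.
Qed.

Lemma quotient_tgt d : tgt (dart_orbit d : edge Q) = cell_orbit (inr d.1).
Proof.
rewrite /tgt /=; case: (dart_orbit_val d) => /= -> //.
by rewrite iota_edge -[RHS]cell_orbit_iota.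
Qed.

(** Deleting the half-edge under a dart cuts the quotient tree in two.  The
    cells over the part containing the midpoint form an invariant set which
    no half-edge other than the deleted ones enters or leaves. *)
Lemma separating_set d0 : exists S : pred cellT,
  [/\ forall z, S (iota_cell z) = S z, S (inr d0.1), ~~ S (inl (orig d0)) &
      forall d, d != d0 -> d != i.2 d0 -> S (inl (orig d)) = S (inr d.1)].
Proof.
have [_ acyc] := quotient_tree G.
pose D : dart Q := (dart_orbit d0, false).
exists (fun z => connect (off_edge D) (dest D) (cell_orbit z)); split.
- by move=> z; rewrite cell_orbit_iota.
- by rewrite (quotient_tgt d0 : dest D = _).
- by have := tree_cut acyc D; rewrite (quotient_src d0 : orig D = _).
move=> d dd0 did0; apply: (same_connect_r (off_edge_sym D)).
apply/connect1/existsP; exists (dart_orbit d, false).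
pose D' : dart Q := (dart_orbit d, false).
rewrite -/D' (quotient_src d : orig D' = _) (quotient_tgt d : dest D' = _).
rewrite !eqxx !andbT /=.
apply: contraNneq dd0 => od.
have [] := dart_orbit_val d; rewrite od; have [] := dart_orbit_val d0 => -> //.
- by move=> ->.
- by move=> id0; rewrite -id0 eqxx in did0.
- by move=> d0E; rewrite d0E iota_dartK eqxx in did0.
- by move=> /(inv_inj iota_dartK) ->.
Qed.

Lemma dart_coef_dflip (c : chain G) d : dart_coef c (dflip d) = - dart_coef c d.
Proof. by case: d => e []; rewrite /dart_coef /= ?expr1 ?expr0 !mulN1r ?mul1r ?opprK. Qed.

Lemma sum_dart_coef (c : chain G) v :
  c \in @is_1cycle G -> \sum_(d : dart G | orig d == v) dart_coef c d = 0.
Proof.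
by move=> /forallP/(_ v); rewrite boundary_dart oppr_eq0 => /eqP.
Qed.

(** Since the quotient is a tree, the involution acts on the homology as -1. *)
Lemma iota_cycle (c : chain G) d0 :
  c \in @is_1cycle G -> dart_coef c (i.2 d0) = - dart_coef c d0.
Proof.
move=> cc; pose y d := dart_coef c d + dart_coef c (i.2 d).
suff: y d0 = 0 by move=> /eqP; rewrite /y addrC addr_eq0 => /eqP.
have yi d : y (i.2 d) = y d by rewrite /y iota_dartK addrC.
have yf d : y (dflip d) = - y d.
  by rewrite /y iota_dflip !dart_coef_dflip opprD.
(* y = c + i c is an invariant cycle; its boundary over the part S of a cut of
   the quotient tree at d0 is the flow through the deleted half-edges. *)
have [S [Si Sm So Sd]] := separating_set d0.
have sv v : \sum_(d : dart G | orig d == v) y d = 0.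
  rewrite big_split /= sum_dart_coef // add0r.
  rewrite (reindex_inj (@perm_inj _ i.2)) /=.
  rewrite -[RHS](sum_dart_coef (i.1 v) cc); apply: eq_big => d.
    by rewrite iota_orig; apply/eqP/eqP => [<-|->]; rewrite iota_vertexK.
  by rewrite iota_dartK.
have s1 : \sum_(d : dart G | S (inl (orig d))) y d = 0.
  rewrite (partition_big (@orig G) (fun v => S (inl v))) //=.
  apply: big1 => v Sv; rewrite -[RHS](sv v); apply: eq_bigl => d.
  by case: eqP => [->|]; rewrite ?Sv ?andbF.
have s2 : \sum_(d : dart G | S (inr d.1)) y d = 0.
  have: \sum_(d : dart G | S (inr d.1)) y d = - \sum_(d : dart G | S (inr d.1)) y d.
    rewrite {1}(reindex_inj (inv_inj (@dflipK G))) /= -sumrN.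
    by apply: eq_bigr => d _; rewrite yf.
  by move=> /eqP; rewrite -addr_eq0 -mulr2n mulrn_eq0 => /eqP.
have Sim : S (inr (i.2 d0).1) by rewrite iota_edge -[inr _]/(iota_cell (inr d0.1)) Si.
have Sio : ~~ S (inl (orig (i.2 d0))).
  by rewrite iota_orig -[inl _]/(iota_cell (inl (orig d0))) Si.
have s3 : \sum_(d : dart G | S (inl (orig d))) y d =
    \sum_(d : dart G | S (inr d.1) && ((d != d0) && (d != i.2 d0))) y d.
  apply: eq_bigl => d; have [->|dd0] := eqVneq d d0.
    by rewrite (negbTE So) andbF.
  have [->|did0] := eqVneq d (i.2 d0); first by rewrite (negbTE Sio) andbF.
  by rewrite Sd ?andbT.
move: s2; rewrite (bigID (fun d : dart G => (d != d0) && (d != i.2 d0))) /= -s3 s1 add0r.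
rewrite (bigD1 d0) ?Sm ?eqxx //=.
have [id0|id0] := eqVneq (i.2 d0) d0.
  rewrite big1 ?addr0 // => d; rewrite id0 andbb negbK -andbA.
  by case: eqP; rewrite ?andbF.
rewrite (bigD1 (i.2 d0)) ?Sim ?id0 ?eqxx ?andbF //= yi big1 ?addr0.
  by move=> /eqP; rewrite -mulr2n mulrn_eq0 => /eqP.
move=> d /andP[/andP[/andP[_ +] dd0] did0].
by rewrite dd0 did0.
Qed.

(** * Homology classes modulo two *)

(** A choice of one dart in each pair of darts exchanged by the involution. *)
Definition half_dart d : bool := (enum_rank d < enum_rank (i.2 d))%N.

Lemma half_dart_iota d : i.2 d != d -> half_dart (i.2 d) = ~~ half_dart d.
Proof.
move=> nd; rewrite /half_dart iota_dartK -leqNgt ltn_neqAle.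
by rewrite (inj_eq val_inj) (inj_eq enum_rank_inj) nd.
Qed.

Lemma half_dart_nfixed d : half_dart d -> i.2 d != d.
Proof. by apply: contraTneq => id; rewrite /half_dart id ltnn. Qed.

Lemma half_dart_flipped e : flipped_edge e ->
  half_dart (e, true) = ~~ half_dart (e, false).
Proof. by move=> fe; rewrite -half_dart_iota ?flipped_edge_dart // xpair_eqE andbF. Qed.

(** The reduction of a chain modulo two; it ignores the orientation of edges. *)
Definition mod2 (c : chain G) e : 'F_2 := (c e)%:~R.

Lemma mod2D c c' e : mod2 (c + c') e = mod2 c e + mod2 c' e.
Proof. by rewrite /mod2 ffunE rmorphD. Qed.

Lemma mod2N c e : mod2 (- c) e = mod2 c e.
Proof. by rewrite /mod2 ffunE rmorphN F2_oppr. Qed.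

Lemma dart_coef_mod2 c d : (dart_coef c d)%:~R = mod2 c d.1.
Proof.
rewrite /dart_coef /mod2; case: d => e []; rewrite /= ?expr0 ?mul1r // expr1 mulN1r.
by rewrite rmorphN F2_oppr.
Qed.

Lemma boundary_mod2 c v :
  (boundary c v)%:~R = \sum_(d : dart G | orig d == v) mod2 c d.1 :> 'F_2.
Proof.
rewrite boundary_dart rmorphN F2_oppr rmorph_sum.
by apply: eq_bigr => d _; rewrite /= dart_coef_mod2.
Qed.

Lemma mod2_cycle_iota c e :
  c \in @is_1cycle G -> mod2 c (edge_act i e) = mod2 c e.
Proof.
move=> cc; have := congr1 (fun z : int => z%:~R : 'F_2) (iota_cycle (e, false) cc).
rewrite /= rmorphN F2_oppr dart_coef_mod2 iota_edge /= => ->.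
exact: (dart_coef_mod2 c (e, false)).
Qed.

Lemma cycle_fixed_edge c e : c \in @is_1cycle G -> fixed_edge e -> c e = 0.
Proof.
move=> cc /eqP fe; have := iota_cycle (e, false) cc.
rewrite fe /dart_coef expr0 mul1r => /eqP.
by rewrite -addr_eq0 -mulr2n mulrn_eq0 => /eqP.
Qed.

Lemma sum_boundary_mod2 c v : c \in @is_1cycle G ->
  \sum_(d : dart G | orig d == v) mod2 c d.1 = 0.
Proof. by move=> /forallP/(_ v)/eqP cv; rewrite -boundary_mod2 cv. Qed.

(** The fixed vertices and the midpoints of flipped edges.  Midpoints of fixed
    edges are left out; every component of the fixed locus still contains a fixed
    cell, and midpoints of flipped edges are isolated in it. *)
Definition fixed_cell (a : cellT) : bool :=
  match a with inl v => i.1 v == v | inr e => flipped_edge e end.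

(** The boundary modulo two, at a fixed cell, of the chain on the quotient tree
    of which a given anti-invariant chain is the transfer.  An edge of the tree at
    a fixed vertex is the image of one fixed dart, whose coefficient is zero, or
    of two exchanged darts, only one of which is counted. *)
Definition cell_boundary (c : chain G) (a : cellT) : 'F_2 :=
  match a with
  | inl v => \sum_(d : dart G | half_dart d && (orig d == v)) mod2 c d.1
  | inr e => mod2 c e
  end.

(** The total boundary over the fixed cells in K. *)
Definition part_boundary (c : chain G) (K : pred cellT) : 'F_2 :=
  \sum_(a | fixed_cell a && K a) cell_boundary c a.

Lemma cell_boundaryD c c' a :
  cell_boundary (c + c') a = cell_boundary c a + cell_boundary c' a.
Proof.
case: a => [v|e] /=; last exact: mod2D.
by rewrite -big_split; apply: eq_bigr => d _; rewrite mod2D.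
Qed.

Lemma part_boundaryD c c' K :
  part_boundary (c + c') K = part_boundary c K + part_boundary c' K.
Proof.
by rewrite -big_split; apply: eq_bigr => d _; rewrite cell_boundaryD.
Qed.

Lemma sum_cells (A : pred cellT) (h : cellT -> 'F_2) :
  \sum_(a | A a) h a =
  \sum_(v | A (inl v)) h (inl v) + \sum_(e | A (inr e)) h (inr e).
Proof. by rewrite big_sumType. Qed.

(** On an invariant set of cells, the boundary of a cycle counts the half-edges
    leaving that set. *)
Lemma part_boundary_cut c (S : pred cellT) : c \in @is_1cycle G ->
    (forall z, S (iota_cell z) = S z) ->
  part_boundary c S =
  \sum_(d | half_dart d) mod2 c d.1 *
     ((S (inl (orig d)))%:R + (S (inr d.1))%:R).
Proof.
move=> cc Si.
under eq_bigr do rewrite mulrDr.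
rewrite big_split /= /part_boundary sum_cells /=; congr (_ + _).
  (* The exchanged vertices may be added to the sum: they cancel in pairs. *)
  transitivity (\sum_(v | S (inl v)) cell_boundary c (inl v)).
    rewrite [RHS](sum_involution iota_vertexK).
    - by apply: eq_bigl => v; rewrite andbC.
    - by move=> v; rewrite -[RHS]Si.
    move=> v _ /=; have [-> //|nv] := eqVneq (i.1 v) v.
    apply/eqP; rewrite -subr_eq0 F2_oppr.
    rewrite (reindex_inj (@perm_inj _ i.2)) /=.
    rewrite [X in X + _](eq_big (fun d => (orig d == v) && ~~ half_dart d)
       (fun d => mod2 c d.1)).
    - rewrite addrC [X in X + _](eq_bigl (fun d => (orig d == v) && half_dart d)).
        by rewrite -bigID sum_boundary_mod2.
      by move=> d; rewrite andbC.
    - move=> d; rewrite iota_orig (inj_eq (inv_inj iota_vertexK)) andbC.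
      case: eqP => //= od; rewrite half_dart_iota //.
      by apply: contraNneq nv => /(congr1 (@orig G)); rewrite iota_orig od => ->.
    by move=> d _; rewrite iota_edge mod2_cycle_iota.
  rewrite [RHS](partition_big (@orig G) predT) //= big_mkcond /=.
  apply: eq_bigr => v _; case: ifP => Sv.
    by apply: eq_bigr => d /andP[_ /eqP ->]; rewrite Sv mulr1.
  by rewrite big1 // => d /andP[_ /eqP ->]; rewrite Sv mulr0.
(* Likewise the midpoints of exchanged edges cancel in pairs, and exactly one of
   the two darts of a flipped edge is counted. *)
transitivity (\sum_(e | S (inr e)) mod2 c e *
    ((half_dart (e, false))%:R + (half_dart (e, true))%:R)).
  rewrite [RHS](sum_involution iota_edgeK).
  - rewrite [RHS](bigID fixed_edge) /= [X in _ = X + _]big1 ?add0r; last first.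
      by move=> e /andP[_ fe]; rewrite /mod2 cycle_fixed_edge // mul0r.
    apply: eq_big => e.
      rewrite iota_edge_fixed andbC -andbA; congr (_ && _).
      by case fe: (fixed_edge e); rewrite ?andbF ?(fixed_flipped fe) ?andbT.
    move=> /andP[fe _]; rewrite half_dart_flipped //.
    by case: half_dart; rewrite /= ?addr0 ?add0r mulr1.
  - by move=> e; rewrite -[RHS]Si.
  move=> e _; rewrite mod2_cycle_iota //.
  have [-> //|ne] := eqVneq (edge_act i e) e; congr (_ * _).
  have hi b : half_dart (i.2 (e, b)) = ~~ half_dart (e, b).
    by apply: half_dart_iota; apply: contraNneq ne => eb; rewrite -(iota_edge (e, b)) eb.
  have Ei : (i.2 (e, false), i.2 (e, true)) =
      ((edge_act i e, (i.2 (e, false)).2), (edge_act i e, ~~ (i.2 (e, false)).2)).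
    rewrite -[(e, true)]/(dflip (e, false)) iota_dflip /edge_act.
    by case: (i.2 (e, false)).
  have [] := Ei => E1 E2; have := hi false; have := hi true; rewrite E1 E2.
  case: (i.2 (e, false)).2 => /= -> ->;
    by case: half_dart; case: half_dart; rewrite /= ?addr0 ?add0r ?F2_addrr.
rewrite [RHS](partition_big fst predT) //= big_mkcond /=.
apply: eq_bigr => e _; rewrite (eq_bigl (fun d => (d.1 == e) && half_dart d)); last first.
  by move=> d; rewrite andbC.
transitivity (\sum_(b : bool) if half_dart (e, b) then mod2 c e * (S (inr e))%:R else 0).
  rewrite big_bool; case: (S _); last by rewrite /= mulr0 !if_same addr0.
  by rewrite /= mulr1 addrC mulrDr; do 2!case: half_dart; rewrite ?mulr1 ?mulr0.
rewrite -big_mkcondr /=.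
rewrite (reindex_onto (fun b : bool => (e, b)) snd) /=.
  by apply: eq_bigl => b; rewrite !eqxx andbT.
by move=> [e' b] /= /andP[/eqP ->].
Qed.

Lemma part_boundary_total c : c \in @is_1cycle G -> part_boundary c predT = 0.
Proof.
move=> cc; rewrite (part_boundary_cut cc) // big1 // => d _.
by rewrite F2_addrr mulr0.
Qed.

(** Sets of cells that are unions of components over the fixed subgraph. *)
Definition fixed_closed (S : pred cellT) :=
  forall d, fixed_edge d.1 -> S (inl (orig d)) = S (inr d.1).

(** An odd coefficient is detected by the boundary on one side of the edge. *)
Lemma odd_edge_cut c e : c \in @is_1cycle G -> mod2 c e != 0 ->
  exists2 S : pred cellT, fixed_closed S & part_boundary c S = mod2 c e.
Proof.
move=> cc ne0; pose d0 : dart G := (e, false).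
have nf : i.2 d0 != d0.
  rewrite fixed_dart_edge; apply: contraNN ne0 => fe.
  by rewrite /mod2 cycle_fixed_edge.
have [S [Si Sm So Sd]] := separating_set d0.
have Sim : S (inr (i.2 d0).1).
  by rewrite iota_edge -[inr _]/(iota_cell (inr d0.1)) Si.
have Sio : S (inl (orig (i.2 d0))) = false.
  by rewrite iota_orig -[inl _]/(iota_cell (inl (orig d0))) Si; apply: negbTE.
exists S => [d fd|].
  apply: Sd; first by apply: contraNneq nf => <-; rewrite fixed_dart_edge.
  apply: contraNneq nf => d0E; move: fd; rewrite -fixed_dart_edge d0E iota_dartK.
  by rewrite eq_sym.
(* d1 is the dart counted among d0 and i d0, the only ones crossing the cut. *)
pose d1 := if half_dart d0 then d0 else i.2 d0.
have hd1 : half_dart d1.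
  by rewrite /d1; case hd: (half_dart d0) => //; rewrite half_dart_iota ?hd.
rewrite (part_boundary_cut cc) // (bigD1 d1) //= big1 ?addr0; last first.
  move=> d /andP[hd dd1]; rewrite Sd ?F2_addrr ?mulr0 //.
    apply: contraNneq dd1 => dE; rewrite /d1 -dE hd eqxx //.
  apply: contraNneq dd1 => dE; rewrite /d1; case: ifP => [hd0|]; last by rewrite dE.
  by move: hd; rewrite dE half_dart_iota ?hd0.
rewrite /d1; case: ifP => _; first by rewrite (negbTE So) Sm add0r mulr1.
by rewrite Sio Sim add0r mulr1 iota_edge mod2_cycle_iota.
Qed.

(** The boundary at a fixed vertex does not depend on which dart is chosen in
    each exchanged pair. *)
Lemma dart_choice_sum (s s' : pred (dart G)) (u : dart G -> 'F_2) v :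
    (forall d, i.2 d != d -> s (i.2 d) = ~~ s d) ->
    (forall d, i.2 d != d -> s' (i.2 d) = ~~ s' d) ->
    (forall d, u (i.2 d) = u d) -> (forall d, i.2 d = d -> u d = 0) ->
    i.1 v = v ->
  \sum_(d | s d && (orig d == v)) u d = \sum_(d | s' d && (orig d == v)) u d.
Proof.
move=> si si' ui u0 iv; apply/eqP; rewrite -subr_eq0 F2_oppr; apply/eqP.
under eq_bigl do rewrite andbC.
under [X in _ + X]eq_bigl do rewrite andbC.
rewrite !big_mkcondr -big_split /=.
rewrite (sum_involution iota_dartK).
- by rewrite big1 // => d /andP[_ /eqP /u0 ->]; rewrite !if_same addr0.
- by move=> d; rewrite iota_orig -{1}iv (inj_eq (inv_inj iota_vertexK)).
move=> d _; rewrite ui; have [-> //|nd] := eqVneq (i.2 d) d.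
by rewrite si // si' //; case: (s d); case: (s' d) => /=; rewrite ?addr0 ?add0r ?F2_addrr.
Qed.

(** * Cycles with prescribed boundary *)

Lemma boundaryD c c' v : boundary (c + c') v = boundary c v + boundary c' v.
Proof.
rewrite !boundary_dart -opprD -big_split; congr (- _).
by apply: eq_bigr => d _; rewrite /dart_coef ffunE mulrDr.
Qed.

Lemma boundaryN c v : boundary (- c) v = - boundary c v.
Proof.
rewrite !boundary_dart; congr (- _); rewrite -sumrN.
by apply: eq_bigr => d _; rewrite /dart_coef ffunE mulrN.
Qed.

Lemma boundary_act (f : graph_perm G) c v : is_graph_aut f ->
  boundary (chain_act f c) (f.1 v) = boundary c v.
Proof.
move=> af; rewrite !boundary_dart; congr (- _).
rewrite (reindex_inj (@perm_inj _ f.2)) /=; apply: eq_big => d.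
  by rewrite aut_orig // (inj_eq (@perm_inj _ f.1)).
by rewrite dart_coef_act // permK.
Qed.

(** The chain with coefficient 1 along a given dart. *)
Definition dart_chain d : chain G :=
  [ffun e => if e == d.1 then (-1) ^+ d.2 else 0].

Lemma boundary_dart_chain d v :
  boundary (dart_chain d) v = (dest d == v)%:R - (orig d == v)%:R.
Proof.
rewrite /boundary big_mkcond [X in _ - X]big_mkcond /=.
rewrite (bigD1 d.1) //= [X in _ - X](bigD1 d.1) //=.
rewrite !big1 => [|e /negbTE ne|e /negbTE ne]; rewrite ?ffunE ?ne ?if_same //.
rewrite eqxx !addr0 /dest /orig /dflip; case: d => e [] /=; rewrite ?expr1 ?expr0.
  by do 2!case: eqP => _; rewrite ?subr0 ?sub0r ?opprK ?subrr ?oppr0.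
by do 2!case: eqP => _; rewrite ?subr0 ?sub0r ?opprK ?subrr ?oppr0.
Qed.

Lemma walk_chain p u v : walk u p v ->
  exists c : chain G, forall w, boundary c w = (v == w)%:R - (u == w)%:R.
Proof.
elim: p u => [|d p IH] u /= => [/eqP ->|/andP[/eqP ou /IH [c bc]]].
  exists 0 => w; rewrite subrr /boundary !big1 ?subrr // => e _; by rewrite ffunE.
exists (dart_chain d + c) => w; rewrite boundaryD boundary_dart_chain bc ou.
by rewrite addrC addrA subrK.
Qed.

(** Antisymmetrizing a chain retains its boundary modulo two at the fixed
    vertices. *)
Lemma part_boundary_antisym c (K : pred cellT) :
    (forall d, fixed_edge d.1 -> K (inl (orig d)) = K (inl (dest d))) ->
  part_boundary (c - chain_act i c) K =
  \sum_(v | (i.1 v == v) && K (inl v)) (boundary c v)%:~R.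
Proof.
move=> Kf.
have mi e : mod2 (chain_act i c) e = mod2 c (edge_act i e).
  rewrite -[e in LHS]/((e, false).1) -(dart_coef_mod2 _ (e, false)).
  by rewrite dart_coef_act ?iota_aut // iotaV dart_coef_mod2.
rewrite /part_boundary sum_cells /= [X in _ + X]big1 ?addr0; last first.
  move=> e /andP[fe _]; rewrite mod2D mod2N mi.
  have /eqP -> : edge_act i e == e by rewrite iota_edge_fixed fe orbT.
  exact: F2_addrr.
(* At a fixed vertex the counted darts of c and of its image together give all
   darts that are not fixed. *)
have fin v : (i.1 v == v) && K (inl v) ->
    \sum_(d | half_dart d && (orig d == v)) mod2 (c - chain_act i c) d.1 =
    \sum_(d : dart G | (orig d == v)) mod2 c d.1 +
    \sum_(d | (orig d == v) && (i.2 d == d)) mod2 c d.1.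
  move=> /andP[/eqP iv _].
  under eq_bigr do rewrite mod2D mod2N mi -iota_edge.
  rewrite big_split /= [X in _ + X](reindex_inj (inv_inj iota_dartK)) /=.
  under [X in _ + X]eq_bigr do rewrite iota_dartK.
  rewrite [X in _ = X + _](bigID (fun d => i.2 d == d)) /=.
  rewrite [RHS]addrAC F2_addrr add0r [RHS](bigID half_dart) /=.
  congr (_ + _); apply: eq_bigl => d.
    rewrite [RHS]andbAC; case hd: (half_dart d) => /=; last by rewrite !andbF.
    by rewrite half_dart_nfixed // !andbT.
  rewrite iota_orig -{1}iv (inj_eq (inv_inj iota_vertexK)) andbC -andbA.
  congr (_ && _); have [id|nd] := eqVneq (i.2 d) d.
    by rewrite id /half_dart id ltnn.
  by rewrite half_dart_iota.
rewrite (eq_bigr _ fin) big_split /= [X in _ + X](_ : _ = 0) ?addr0.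
  by apply: eq_bigr => v _; rewrite boundary_mod2.
(* Both darts of a fixed edge are counted, or none, since K contains both its
   ends or none. *)
transitivity (\sum_(d : dart G | (i.2 d == d) && K (inl (orig d))) mod2 c d.1).
  rewrite [RHS](partition_big (@orig G) (fun v => (i.1 v == v) && K (inl v))) /=.
    apply: eq_bigr => v /andP[_ Kv]; apply: eq_bigl => d.
    by have [->|] := eqVneq (orig d) v; rewrite ?Kv ?andbF ?andbT.
  by move=> d /andP[/eqP id ->]; rewrite -iota_orig id eqxx.
rewrite (sum_involution (@dflipK G)).
- by rewrite big1 // => -[e b] /andP[_ /eqP[]]; case: b.
- move=> d; rewrite iota_dflip (inj_eq (inv_inj (@dflipK G))).
  have [id|//] := eqVneq (i.2 d) d; rewrite /= -[orig (dflip d)]/(dest d) -Kf //.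
  by rewrite -fixed_dart_edge id.
by [].
Qed.

(** The dart counted on a flipped edge starts at a vertex satisfying P as soon as
    both ends, which are exchanged, do. *)
Lemma half_dart_edge e (P : pred (vertex G)) : flipped_edge e ->
    P (src e) = P (tgt e) ->
  \sum_(d | half_dart d && P (orig d)) (if d.1 == e then 1 else 0) =
  (P (src e))%:R :> 'F_2.
Proof.
move=> fe Pe; rewrite -big_mkcondr /=.
rewrite (reindex_onto (fun b : bool => (e, b)) snd) /=; last first.
  by move=> [e' b] /= /andP[_ /eqP ->].
rewrite (eq_bigl (fun b => half_dart (e, b) && P (src e))); last first.
  move=> b; rewrite !eqxx !andbT; congr (_ && _).
  by rewrite /orig; case: b => /=.
rewrite big_mkcond big_bool /= half_dart_flipped //.
by case: (P _); case: half_dart; rewrite /= ?addr0 ?add0r.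
Qed.

(** Every fixed cell a is joined to a vertex u in such a way that A, the
    difference between the joining path and its image under the involution, is an
    integral chain: the path is trivial if a is a vertex, and half of the flipped
    edge if a is its midpoint. *)
Lemma fixed_cell_root a : fixed_cell a -> exists u, exists A : chain G,
  (forall w, boundary A w = (u == w)%:R - (i.1 u == w)%:R) /\
  forall K : pred cellT, part_boundary A K =
    (K a)%:R + ((i.1 u == u) && K (inl u))%:R.
Proof.
case: a => [v|e] /= fa.
  exists v, 0; split=> [w|K].
    by rewrite (eqP fa) subrr /boundary !big1 ?subrr // => e _; rewrite ffunE.
  rewrite fa F2_addrr /part_boundary big1 // => -[w|e] _ /=.
    by rewrite big1 // => d _; rewrite /mod2 ffunE.
  by rewrite /mod2 ffunE.
exists (src e), (dart_chain (e, true)); split=> [w|K].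
  by rewrite boundary_dart_chain flipped_edge_tgt.
have md e' : mod2 (dart_chain (e, true)) e' = if e' == e then 1 else 0.
  by rewrite /mod2 ffunE /=; case: eqP => // _; rewrite expr1 rmorphN F2_oppr.
rewrite /part_boundary sum_cells addrC; congr (_ + _).
  rewrite big_mkcond (bigD1 e) //= big1 ?addr0 => [|e' ne].
    by rewrite fa md eqxx; case: (K _).
  by rewrite md (negbTE ne) if_same.
rewrite -(@half_dart_edge e (fun v => (i.1 v == v) && K (inl v))) //; last first.
  rewrite -flipped_edge_tgt // iota_vertexK eq_sym.
  by case: eqP => // <-.
rewrite [RHS](partition_big (@orig G) (fun v => (i.1 v == v) && K (inl v))) /=; last first.
  by move=> d /andP[].
apply: eq_bigr => v /andP[iv Kv]; apply: eq_big => [d|d _]; last by rewrite md.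
by rewrite -andbA; case: eqP => [->|]; rewrite ?iv ?Kv ?andbF.
Qed.

(** For any two fixed cells there is a cycle of which they form the boundary on
    the quotient tree: antisymmetrize a path from the one to the other. *)
Lemma cycle_between p q : fixed_cell p -> fixed_cell q ->
  exists2 c : chain G, c \in @is_1cycle G & forall K : pred cellT,
    (forall d, fixed_edge d.1 -> K (inl (orig d)) = K (inl (dest d))) ->
    part_boundary c K = (K p)%:R + (K q)%:R.
Proof.
move=> /fixed_cell_root[u [A [bA pA]]] /fixed_cell_root[v [B [bB pB]]].
have [_ /(_ u v) [w /walk_chain [c bc]]] := hgraph_connected G.
exists (A + (c - chain_act i c) - B) => [|K Kf].
  apply/forallP => x; rewrite !boundaryD !boundaryN bA bB bc.
  rewrite -[x in boundary (chain_act _ _) x]iota_vertexK boundary_act ?iota_aut // bc.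
  rewrite -[v == i.1 x](inj_eq (inv_inj iota_vertexK)) iota_vertexK.
  rewrite -[u == i.1 x](inj_eq (inv_inj iota_vertexK)) iota_vertexK.
  apply/eqP; ring.
have pN : part_boundary (- B) K = part_boundary B K.
  apply: eq_bigr => -[x|e] _ /=; last exact: mod2N.
  by apply: eq_bigr => d _; apply: mod2N.
rewrite (part_boundaryD _ (- B)) (part_boundaryD A) pN pA pB part_boundary_antisym //.
have -> : \sum_(x | (i.1 x == x) && K (inl x)) (boundary c x)%:~R =
    ((i.1 u == u) && K (inl u))%:R + ((i.1 v == v) && K (inl v))%:R :> 'F_2.
  under eq_bigr do rewrite bc rmorphB /= F2_oppr.
  have si y : \sum_(x | (i.1 x == x) && K (inl x)) (y == x)%:R%:~R =
      ((i.1 y == y) && K (inl y))%:R :> 'F_2.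
    rewrite big_mkcond (bigD1 y) //= big1 ?addr0 ?eqxx => [|x /negbTE nx].
      by case: (_ && _).
    by rewrite (eq_sym y) nx if_same.
  by rewrite big_split /= !si addrC.
move: (_ && _) (_ && _) => b b'.
by case: b; case: b'; case: (K p); case: (K q); apply/eqP.
Qed.

(** * Divisibility of cycles by two *)

Lemma intr_F2_eq0 (z : int) : (z%:~R : 'F_2) = 0 -> exists z', z = z' *+ 2.
Proof.
move=> z0; exists (z %/ 2)%Z; suff r0 : (z %% 2)%Z = 0.
  by rewrite [LHS](divz_eq z 2) r0 addr0 -[RHS]mulr_natr.
have : ((z %% 2)%Z%:~R : 'F_2) = 0.
  have := z0; rewrite {1}(divz_eq z 2) rmorphD rmorphM /=.
  by rewrite (_ : (2 : int)%:~R = 0 :> 'F_2) ?mulr0 ?add0r //; apply/eqP.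
have := @ltz_pmod z 2 isT; have := @modz_ge0 z 2 isT.
by case: (_ %% _)%Z => [[|[|n]]|].
Qed.

Lemma cycle_halve c : c \in @is_1cycle G -> (forall e, mod2 c e = 0) ->
  exists2 c' : chain G, c' \in @is_1cycle G & c = c' *+ 2.
Proof.
move=> cc c0; have [h hE] := choice (fun e => intr_F2_eq0 (c0 e)).
pose c' : chain G := [ffun e => h e].
have cE : c = c' + c' by apply/ffunP => e; rewrite !ffunE hE mulr2n.
exists c'; last by rewrite mulr2n.
apply/forallP => v; have := forallP cc v; rewrite cE boundaryD -mulr2n.
by rewrite mulrn_eq0.
Qed.

(** * Intersection numbers modulo two *)

(** Exchanged edges contribute twice, and cycles vanish on fixed edges. *)
Lemma sum_flipped_edges (L : edge G -> 'F_2) c c' :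
    c \in @is_1cycle G -> c' \in @is_1cycle G ->
    (forall e, L (edge_act i e) = L e) ->
  \sum_e L e * mod2 c e * mod2 c' e =
  \sum_(e | flipped_edge e) L e * mod2 c e * mod2 c' e.
Proof.
move=> cc cc' Li; rewrite (sum_involution iota_edgeK) //; last first.
  by move=> e _; rewrite Li !mod2_cycle_iota.
rewrite (bigID fixed_edge) /= big1 ?add0r => [|e /andP[_ fe]].
  apply: eq_bigl => e; rewrite iota_edge_fixed.
  by case fe: (fixed_edge e); rewrite ?andbT ?(fixed_flipped fe).
by rewrite /mod2 cycle_fixed_edge // mulr0 mul0r.
Qed.

(** * Automorphisms commuting with the involution *)

Section CommutingAutomorphism.
Variable f : graph_perm G.
Hypothesis af : is_graph_aut f.
Hypothesis fi : (f * i = i * f)%g.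

Lemma aut_iota_dart d : f.2 (i.2 d) = i.2 (f.2 d).
Proof. by have /permP/(_ d) := congr1 snd fi; rewrite /= !permM. Qed.

Lemma aut_iota_vertex v : f.1 (i.1 v) = i.1 (f.1 v).
Proof. by have /permP/(_ v) := congr1 fst fi; rewrite /= !permM. Qed.

Lemma aut_flipped_edge e : flipped_edge (edge_act f e) = flipped_edge e.
Proof.
have fd d : (i.2 (f.2 d) == dflip (f.2 d)) = (i.2 d == dflip d).
  by rewrite -aut_iota_dart -aut_dflip // (inj_eq (@perm_inj _ f.2)).
have E e' b : (i.2 (e', b) == dflip (e', b)) = flipped_edge e'.
  case: b; last by [].
  rewrite /flipped_edge -[(e', true)]/(dflip (e', false)) iota_dflip.
  by rewrite (inj_eq (inv_inj (@dflipK G))).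
rewrite -[RHS](E e false) -fd /edge_act; case: (f.2 _) => e' b /=.
by rewrite E.
Qed.

Lemma aut_fixed_cell a : fixed_cell (subdivision_vertex_act f a) = fixed_cell a.
Proof.
case: a => [v|e] /=; last exact: aut_flipped_edge.
by rewrite -aut_iota_vertex (inj_eq (@perm_inj _ f.1)).
Qed.

Lemma mod2_act c d : mod2 (chain_act f c) (f.2 d).1 = mod2 c d.1.
Proof. by rewrite -!dart_coef_mod2 dart_coef_act // permK. Qed.

Lemma cell_boundary_act c a : c \in @is_1cycle G -> fixed_cell a ->
  cell_boundary (chain_act f c) (subdivision_vertex_act f a) = cell_boundary c a.
Proof.
move=> cc; case: a => [v /eqP iv|e _] /=; last exact: (mod2_act c (e, false)).
rewrite (reindex_inj (@perm_inj _ f.2)) /=.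
under eq_bigr do rewrite mod2_act.
under eq_bigl do rewrite aut_orig // (inj_eq (@perm_inj _ f.1)).
apply: (@dart_choice_sum (fun d => half_dart (f.2 d)) half_dart) => //.
- move=> d nd; rewrite aut_iota_dart half_dart_iota // -aut_iota_dart.
  by rewrite (inj_eq (@perm_inj _ f.2)).
- exact: half_dart_iota.
- by move=> d; rewrite iota_edge mod2_cycle_iota.
- move=> d /eqP; rewrite fixed_dart_edge => fe.
  by rewrite /mod2 cycle_fixed_edge.
Qed.

End CommutingAutomorphism.
End HyperellipticInvolution.

(** * Topology of the realization *)

Section Topology.
Variables (R : realType) (G : graph).
Local Notation cellT := (vertex G + edge G)%type.
Local Notation I01 := (set_type (`[0, 1]%classic : set R)).

Definition unit_point (t : R) (t01 : t \in (`[0, 1]%classic : set R)) : I01 :=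
  exist _ t t01.

Lemma half_in : (2^-1 : R) \in (`[0, 1]%classic : set R).
Proof. by rewrite inE /= in_itv /=; apply/andP; split; lra. Qed.

Definition midpoint : I01 := unit_point half_in.

(** The point of the realization at a cell. *)
Definition cell_point (a : cellT) : realization R G :=
  match a with inl v => vertex_point R v | inr e => edge_point e midpoint end.

Lemma realization_eqP (p q : cells R G) :
  reflect (\pi_{eq_quot (@glued R G)} p =
             \pi_{eq_quot (@glued R G)} q :> realization R G)
          (glued p q).
Proof. exact: eqmodP. Qed.

Lemma I01_ge0 (s : I01) : 0 <= \val s.
Proof. by have := valP s; rewrite inE /= in_itv /= => /andP[]. Qed.

Lemma I01_le1 (s : I01) : \val s <= 1.
Proof. by have := valP s; rewrite inE /= in_itv /= => /andP[]. Qed.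

Lemma flipK : involutive (@flip R).
Proof. by move=> s; apply: val_inj; rewrite /= opprB addrC subrK. Qed.

Lemma edge_point0 (e : edge G) (s : I01) :
  \val s = 0 -> edge_point e s = vertex_point R (src e).
Proof.
move=> s0; apply/realization_eqP; rewrite /glued /cell_vertex /= s0 eqxx.
by rewrite eqxx.
Qed.

Lemma edge_point1 (e : edge G) (s : I01) :
  \val s = 1 -> edge_point e s = vertex_point R (tgt e).
Proof.
move=> s1; apply/realization_eqP; rewrite /glued /cell_vertex /= s1 oner_eq0 eqxx.
by rewrite eqxx.
Qed.

(** A point is a vertex or an interior point of an edge. *)
Lemma realization_cases (x : realization R G) :
  (exists v, x = vertex_point R v) \/
  (exists e (s : I01), [/\ x = edge_point e s, 0 < \val s & \val s < 1]).
Proof.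
elim/quotP: x => -[[v|e] s] _.
  left; exists v; congr (\pi _); congr existT; apply: val_inj => /=.
  by have := valP s; rewrite inE => ->.
have [s0|s0] := eqVneq (\val s) 0.
  by left; exists (src e); exact: edge_point0.
have [s1|s1] := eqVneq (\val s) 1.
  by left; exists (tgt e); exact: edge_point1.
right; exists e, s; split=> //; first by rewrite lt_neqAle eq_sym s0 I01_ge0.
by rewrite lt_neqAle s1 I01_le1.
Qed.

(** An interior point of an edge is glued to no other point. *)
Lemma edge_point_inj (e : edge G) (s : I01) (q : cells R G) :
    0 < \val s -> \val s < 1 ->
    edge_point e s = \pi_{eq_quot (@glued R G)} q ->
  q = existT _ (inr e) s.
Proof.
move=> s0 s1 /realization_eqP; rewrite /glued => /orP[/eqP -> //|].
by rewrite /cell_vertex /= (gt_eqF s0) (lt_eqF s1).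
Qed.

Lemma cells_inr_inj (e e' : edge G) (s s' : I01) :
  existT (fun j : cellT => (set_type (@cell R G j) : topologicalType)) (inr e) s =
  existT _ (inr e') s' -> e = e' /\ s = s'.
Proof.
pose coordinate (p : cells R G) := match p with
  existT (inr e) s => Some (e, \val s) | _ => None end.
by move=> /(congr1 coordinate) [-> /val_inj ->].
Qed.

(** A function on the cells extends to the realization by linear interpolation on
    the half-edges: the factors are the piecewise linear functions on [0, 1] equal
    to 1 at one of 0, 1/2, 1 and to 0 at the other two. *)
Definition interpolate_edge (chi : cellT -> R) (e : edge G) (t : R) : R :=
  chi (inl (src e)) * Num.max 0 (1 - 2 * t) + chi (inr e) * (1 - `|2 * t - 1|) +
  chi (inl (tgt e)) * Num.max 0 (2 * t - 1).

Definition interpolate_cells (chi : cellT -> R) (p : cells R G) : R :=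
  match p with
  | existT (inl v) _ => chi (inl v)
  | existT (inr e) s => interpolate_edge chi e (\val s)
  end.

Definition interpolate (chi : cellT -> R) (x : realization R G) : R :=
  interpolate_cells chi (repr x).

Lemma interpolate_edge0 chi e : interpolate_edge chi e 0 = chi (inl (src e)).
Proof.
rewrite /interpolate_edge mulr0 subr0 sub0r normrN normr1 subrr mulr0 addr0.
by rewrite !maxEle ler01 (lerNr 0) oppr0 ler10 mulr1 mulr0 addr0.
Qed.

Lemma interpolate_edge1 chi e : interpolate_edge chi e 1 = chi (inl (tgt e)).
Proof.
rewrite /interpolate_edge mulr1 (_ : 2 - 1 = 1 :> R); last by lra.
rewrite (_ : 1 - 2 = -1 :> R); last by lra.
by rewrite normr1 subrr mulr0 addr0 !maxEle ler01 (lerNr 0) oppr0 ler10 mulr1 mulr0 add0r.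
Qed.

Lemma interpolate_edge_half chi e : interpolate_edge chi e 2^-1 = chi (inr e).
Proof.
rewrite /interpolate_edge mulfV ?pnatr_eq0 // subrr normr0 maxxx subr0.
by rewrite !mulr0 mulr1 addr0 add0r.
Qed.

Lemma interpolate_edge_cst chi e t : chi (inl (src e)) = chi (inr e) ->
  chi (inl (tgt e)) = chi (inr e) -> interpolate_edge chi e t = chi (inr e).
Proof.
rewrite /interpolate_edge => -> ->; rewrite -!mulrDr -[RHS]mulr1; congr (_ * _).
rewrite !maxEle; case: (lerP 0 (2 * t - 1)) => h.
  rewrite (_ : (0 <= 1 - 2 * t) = (2 * t - 1 == 0)); last first.
    by rewrite eq_le h andbT subr_ge0 subr_le0.
  by rewrite ger0_norm //; case: eqP => [|_]; lra.
rewrite ltr0_norm // (_ : 0 <= 1 - 2 * t); lra.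
Qed.

Lemma interpolate_cells_vertex chi p v :
  cell_vertex p = Some v -> interpolate_cells chi p = chi (inl v).
Proof.
case: p => -[w|e] s; rewrite /cell_vertex /interpolate_cells /=; first by case=> ->.
case: eqP => [-> [<-]|_]; first exact: interpolate_edge0.
by case: eqP => [-> [<-]|//]; exact: interpolate_edge1.
Qed.

Lemma interpolate_cells_glued chi p q :
  glued p q -> interpolate_cells chi p = interpolate_cells chi q.
Proof.
move=> /orP[/eqP -> //|/andP[]]; case Ep: (cell_vertex p) => [v|//] _ /eqP Eq.
by rewrite (interpolate_cells_vertex chi Ep) (interpolate_cells_vertex chi (esym Eq)).
Qed.

Lemma interpolate_pi chi p :
  interpolate chi (\pi_{eq_quot (@glued R G)} p) = interpolate_cells chi p.
Proof. by apply: interpolate_cells_glued; apply/realization_eqP; rewrite reprK. Qed.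

Lemma interpolate_vertex chi v : interpolate chi (vertex_point R v) = chi (inl v).
Proof. exact: interpolate_pi. Qed.

Lemma interpolate_point chi e s :
  interpolate chi (edge_point e s) = interpolate_edge chi e (\val s).
Proof. exact: interpolate_pi. Qed.

Lemma interpolate_cell_point chi a : interpolate chi (cell_point a) = chi a.
Proof.
case: a => [v|e]; first exact: interpolate_vertex.
by rewrite /= interpolate_point /= interpolate_edge_half.
Qed.

Lemma interpolate_edge_continuous chi e : continuous (interpolate_edge chi e).
Proof.
have cadd (g h : R -> R) : continuous g -> continuous h ->
    continuous (fun t => g t + h t) by move=> cg ch t; exact: cvgD (cg t) (ch t).
have cmul a (g : R -> R) : continuous g -> continuous (fun t => a * g t).
  by move=> cg t; apply: (continuous_comp (cg t)); exact: mulrl_continuous.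
have copp (g : R -> R) : continuous g -> continuous (fun t => - g t).
  by move=> cg t; exact: cvgN (cg t).
have cst (a : R) : continuous (fun _ : R => a) by move=> t; exact: cvg_cst.
have cabs (g : R -> R) : continuous g -> continuous (fun t => `|g t|).
  by move=> cg t; apply: (continuous_comp (cg t)); exact: norm_continuous.
have cmax (g : R -> R) : continuous g -> continuous (fun t => Num.max 0 (g t)).
  by move=> cg t; exact: (continuous_max (cst 0 t) (cg t)).
have cid : continuous (fun t : R => t) by move=> t; exact: cvg_id.
have c2 := cmul 2 _ cid; have c21 := cadd _ _ c2 (cst (- 1)).
have c12 := cadd _ _ (cst 1) (copp _ c2).
have ca := cadd _ _ (cst 1) (copp _ (cabs _ c21)).
exact: (cadd _ _ (cadd _ _ (cmul (chi (inl (src e))) _ (cmax _ c12))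
  (cmul (chi (inr e)) _ ca)) (cmul (chi (inl (tgt e))) _ (cmax _ c21))).
Qed.

(** A map on the disjoint union of the cells is continuous as soon as it is on
    every cell. *)
Lemma cells_continuous (Z : topologicalType) (h : cells R G -> Z) :
  (forall j, continuous (fun s : set_type (@cell R G j) => h (existT _ j s))) ->
  continuous h.
Proof. by move=> ch [j s] U nU; exact: (ch j s U nU). Qed.

Lemma interpolate_continuous chi : continuous (interpolate chi).
Proof.
apply: repr_comp_continuous.
  apply: cells_continuous => -[v|e]; first exact: cst_continuous.
  move=> s; apply: (@continuous_comp _ _ _ set_val (interpolate_edge chi e)).
    exact: initial_continuous.
  exact: interpolate_edge_continuous.
by move=> p q /eqP/realization_eqP pq; apply/eqP; exact: interpolate_cells_glued.
Qed.

(** A closed edge is the image of the line under a retraction to [0, 1]. *)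
Lemma edge_connected (e : edge G) :
  connected (range (fun s : I01 => edge_point e s : realization R G)).
Proof.
have clampP (t : R) : Num.max 0 (Num.min 1 t) \in (`[0, 1]%classic : set R).
  rewrite inE /= in_itv /= le_max lexx /= ge_max ler01 ge_min lexx //.
pose cl t : I01 := unit_point (clampP t).
have -> : range (fun s : I01 => edge_point e s : realization R G) =
    (fun t => edge_point e (cl t) : realization R G) @` [set: R].
  apply/seteqP; split=> x /= [s _ <-]; last by exists (cl s).
  exists (\val s) => //; congr edge_point; apply: val_inj => /=.
  by rewrite (min_idPr (I01_le1 s)) (max_idPr (I01_ge0 s)).
apply: connected_continuous_connected.
  by apply/connected_intervalP.
apply: continuous_subspaceT => t.
apply: (@continuous_comp _ _ _ cl (fun s => edge_point e s : realization R G)).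
  move: t; apply: (@continuous_comp_initial _ _ _ (set_val : I01 -> R)) => t.
  have cst (a : R) : continuous (fun _ : R => a) by move=> y; exact: cvg_cst.
  have cid : continuous (fun y : R => y) by move=> y; exact: cvg_id.
  have cmin : continuous (fun y : R => Num.min 1 y).
    by move=> y; exact: (continuous_min (cst 1 y) (cid y)).
  exact: (continuous_max (cst 0 t) (cmin t)).
apply: (@continuous_comp _ _ _ (fun s : I01 => existT _ (inr e) s : cells R G)).
  exact: existT_continuous.
exact: pi_continuous.
Qed.

(** * The action on the realization *)

Section Action.
Variables (f : graph_perm G) (af : is_graph_aut f).

Lemma cells_act_vertex (p : cells R G) :
  cell_vertex (cells_act f p) = omap f.1 (cell_vertex p).
Proof.
case: p => -[v|e] s; rewrite /cell_vertex //=.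
have o0 : orig (f.2 (e, false)) = f.1 (src e) by rewrite aut_orig.
have o1 : dest (f.2 (e, false)) = f.1 (tgt e).
  by rewrite /dest -aut_dflip // aut_orig.
have f0 : (\val (flip s) == 0) = (\val s == 1) by rewrite /= subr_eq0 eq_sym.
have f1 : (\val (flip s) == 1) = (\val s == 0).
  by rewrite /= -subr_eq0 addrAC subrr sub0r oppr_eq0.
rewrite /edge_act; move: o0 o1; case: (f.2 _) => e' b; rewrite /dest /orig /=.
case: b => /= o0 o1; rewrite ?f0 ?f1.
  have [s1|_] := eqVneq (\val s) 1; last by case: ifP => //; rewrite o0.
  by rewrite s1 oner_eq0 o1.
by case: ifP => _; [rewrite o0 | case: ifP => //; rewrite o1].
Qed.

Lemma cells_act_glued (p q : cells R G) :
  glued p q -> glued (cells_act f p) (cells_act f q).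
Proof.
move=> /orP[/eqP ->|/andP[np /eqP pq]]; first exact: glued_refl.
rewrite /glued !cells_act_vertex -pq eqxx andbT.
by move: np; case: (cell_vertex p) => // v _; rewrite orbT.
Qed.

Lemma realization_act_pi (p : cells R G) :
  realization_act f (\pi_{eq_quot (@glued R G)} p) =
  \pi_{eq_quot (@glued R G)} (cells_act f p).
Proof.
by apply/realization_eqP/cells_act_glued; apply/realization_eqP; rewrite reprK.
Qed.

Lemma realization_act_vertex v :
  realization_act f (vertex_point R v) = vertex_point R (f.1 v).
Proof.
rewrite /vertex_point realization_act_pi /=; congr (\pi _); congr existT.
exact: val_inj.
Qed.

Lemma realization_act_edge e (s : I01) : realization_act f (edge_point e s) =
  edge_point (edge_act f e) (if (f.2 (e, false)).2 then flip s else s).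
Proof. exact: (realization_act_pi (existT _ (inr e) s)). Qed.

Lemma flip_midpoint : flip midpoint = midpoint.
Proof. by apply: val_inj => /=; lra. Qed.

Lemma realization_act_cell a :
  realization_act f (cell_point a) = cell_point (subdivision_vertex_act f a).
Proof.
case: a => [v|e] /=; first exact: realization_act_vertex.
by rewrite realization_act_edge flip_midpoint if_same.
Qed.

Lemma flip_continuous : continuous (@flip R).
Proof.
apply: (@continuous_comp_initial _ _ _ (set_val : I01 -> R)).
move=> s; apply: (@continuous_comp _ _ _ set_val (fun t : R => 1 - t)).
  exact: initial_continuous.
by move=> t; apply: cvgB; [exact: cvg_cst | exact: cvg_id].
Qed.

Lemma realization_act_continuous : continuous (@realization_act R G f).
Proof.
apply/quotient_continuous.
have -> : realization_act (R := R) f \o \pi_(realization R G) =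
    \pi_(realization R G) \o cells_act f.
  by apply/funext => p /=; exact: realization_act_pi.
move=> p; apply: continuous_comp; last exact: pi_continuous.
move: p; rewrite -/(continuous _).
apply: cells_continuous => -[v|e]; first exact: (@existT_continuous _ _ (inl (f.1 v))).
have ce := @existT_continuous _ (fun j => set_type (@cell R G j) : topologicalType)
  (inr (edge_act f e)).
rewrite /cells_act; case: (_.2); last exact: ce.
by move=> s; apply: (@continuous_comp _ _ _ (@flip R) _ s (@flip_continuous s)); exact: ce.
Qed.

End Action.

Lemma realization_actM (f g : graph_perm G) (x : realization R G) :
    is_graph_aut f -> is_graph_aut g ->
  realization_act (f * g)%g x = realization_act g (realization_act f x).
Proof.
move=> af ag; have afg := graph_autM af ag.
have [[v ->]|[e [s [-> _ _]]]] := realization_cases x.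
  by rewrite !realization_act_vertex // permM.
rewrite !realization_act_edge // edge_actM // permM.
congr edge_point; rewrite /edge_act; case: (f.2 (e, false)) => e' b /=.
have gt : (g.2 (e', true)).2 = ~~ (g.2 (e', false)).2.
  by rewrite -[(e', true)]/(dflip (e', false)) aut_dflip.
by case: b; rewrite ?gt //; case: (_.2); rewrite /= ?flipK.
Qed.

Lemma realization_act1 (x : realization R G) : realization_act 1%g x = x.
Proof.
have [[v ->]|[e [s [-> _ _]]]] := realization_cases x.
  by rewrite realization_act_vertex ?graph_aut1 // perm1.
by rewrite realization_act_edge ?graph_aut1 // /edge_act perm1.
Qed.

End Topology.

(** * Components of the fixed locus *)

Section FixedLocus.
Variables (R : realType) (G : hyperelliptic_graph).
Local Notation i := (Defs.iota G).
Local Notation cellT := (vertex G + edge G)%type.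
Local Notation Fix := (fixed_points i : set (realization R G)).
Local Notation act := (@realization_act R G).
Local Notation ai := (iota_aut G).

(** The component of the fixed locus through the point at a cell. *)
Definition fixed_component (a : cellT) : set (realization R G) :=
  connected_component Fix (cell_point R a).

Lemma vertex_point_inj (H : graph) : injective (@vertex_point R H).
Proof.
move=> v w /realization_eqP /orP[/eqP /(congr1 (@cell_vertex R H))|/andP[_ /eqP]];
by rewrite /cell_vertex /= => -[].
Qed.

Lemma fixed_vertex_point v : Fix (vertex_point R v) <-> i.1 v = v.
Proof.
rewrite /fixed_points /= realization_act_vertex ?ai //.
by split=> [/vertex_point_inj|->].
Qed.

Lemma fixed_edge_points e (s : set_type (`[0, 1]%classic : set R)) :
  fixed_edge e -> Fix (edge_point e s).
Proof.
move=> /eqP fe; rewrite /fixed_points /= realization_act_edge ?ai //.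
by rewrite /edge_act fe.
Qed.

Lemma cell_point_fixed a : fixed_cell a -> Fix (cell_point R a).
Proof.
case: a => [v /eqP iv|e fe]; first exact/fixed_vertex_point.
rewrite /fixed_points /= realization_act_edge ?ai // flip_midpoint if_same.
by congr edge_point; apply/eqP; rewrite iota_edge_fixed (fe : flipped_edge e) orbT.
Qed.

(** The fixed points are the fixed vertices, the points of fixed edges and the
    midpoints of flipped edges. *)
Lemma fixed_point_cases y : Fix y ->
  [\/ exists2 v, i.1 v = v & y = vertex_point R v,
      exists e s, fixed_edge e /\ y = edge_point e s |
      exists2 e, flipped_edge e & y = cell_point R (inr e)].
Proof.
have [[v ->] /fixed_vertex_point iv|[e [s [-> s0 s1]]]] := realization_cases y.
  by constructor 1; exists v.
rewrite /fixed_points /= realization_act_edge ?ai // => /esym/(edge_point_inj s0 s1).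
move=> /cells_inr_inj [ee ss].
have := iota_edge_fixed e; rewrite ee eqxx => /esym/orP[fe|fe].
  by constructor 2; exists e, s.
constructor 3; exists e => //; congr edge_point; apply: val_inj => /=.
by move: ss; rewrite (eqP fe) /= => /(congr1 val) /=; lra.
Qed.

Lemma fixed_edge_component d : fixed_edge d.1 -> forall s,
  fixed_component (inl (orig d)) (edge_point d.1 s).
Proof.
move=> fd s; apply: (@connected_component_max _ _ (range (@edge_point R G d.1))).
- case: d fd => e b fd.
  have z : (0 : R) \in (`[0, 1]%classic : set R) by rewrite inE /= in_itv /= lexx ler01.
  have o : (1 : R) \in (`[0, 1]%classic : set R) by rewrite inE /= in_itv /= lexx ler01.
  case: b fd => fd.
    by exists (unit_point o) => //; rewrite edge_point1.
  by exists (unit_point z) => //; rewrite edge_point0.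
- by move=> _ [t _ <-]; exact: fixed_edge_points.
- exact: edge_connected.
- by exists s.
Qed.

Lemma fixed_component_edge d : fixed_edge d.1 ->
  fixed_component (inl (orig d)) = fixed_component (inl (dest d)).
Proof.
move=> fd; have H := fixed_edge_component fd (midpoint R).
have H' := @fixed_edge_component (dflip d) fd (midpoint R).
rewrite /fixed_component (same_connected_component H).
by rewrite [RHS](same_connected_component H').
Qed.

Definition real_indicator (S : pred cellT) : cellT -> R := fun a => (S a)%:R.

Lemma interpolate_fixed S y : fixed_closed S -> Fix y ->
  interpolate (real_indicator S) y = 0 \/ interpolate (real_indicator S) y = 1.
Proof.
move=> cS /fixed_point_cases [[v _ ->]|[e [s [fe ->]]]|[e _ ->]].
- by rewrite interpolate_vertex /real_indicator; case: (S _); [right | left].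
- have c0 := cS (e, false) fe; have c1 := cS (e, true) fe.
  rewrite interpolate_point interpolate_edge_cst /real_indicator.
  + by case: (S _); [right | left].
  + by rewrite -c0.
  + by rewrite -c1.
by rewrite interpolate_cell_point /real_indicator; case: (S _); [right | left].
Qed.

(** The interpolation of the indicator of S takes only the values 0 and 1 on the
    fixed locus, hence is constant on its components. *)
Lemma interpolate_component S a y : fixed_closed S -> fixed_cell a ->
  fixed_component a y -> interpolate (real_indicator S) y = (S a)%:R.
Proof.
move=> cS fa ay; pose h := interpolate (real_indicator S).
have aa : fixed_component a (cell_point R a).
  by apply: connected_component_refl; exact: cell_point_fixed.
have /connected_intervalP itv : connected (h @` fixed_component a).
  apply: connected_continuous_connected; first exact: component_connected.
  apply: continuous_subspaceT; exact: interpolate_continuous.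
have h01 z : fixed_component a z -> h z = 0 \/ h z = 1.
  by move=> /connected_component_sub; exact: interpolate_fixed.
rewrite -[RHS]/(real_indicator S a) -interpolate_cell_point -/h.
(* A connected set of values containing both 0 and 1 would contain 1/2. *)
have noh : ~ (h @` fixed_component a) 2^-1.
  move=> [z /h01 [] ->] /eqP; rewrite eq_sym ?invr_eq0 ?pnatr_eq0 //.
  by rewrite invr_eq1 (eqr_nat R 2 1).
have ih z : fixed_component a z -> (h @` fixed_component a) (h z) by exists z.
have [] := h01 _ ay; have [] := h01 _ aa => ha hy; rewrite ha hy //; case: noh.
  apply: (itv (h y) (h (cell_point R a))); rewrite ?ha ?hy; do ?exact: ih.
  - by rewrite -hy; exact: ih.
  - by rewrite -ha; exact: ih.
  - by apply/andP; split; lra.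
apply: (itv (h (cell_point R a)) (h y)); rewrite ?ha ?hy.
- by rewrite -ha; exact: ih.
- by rewrite -hy; exact: ih.
- by apply/andP; split; lra.
Qed.

Lemma fixed_component_refl a : fixed_cell a -> fixed_component a (cell_point R a).
Proof. by move=> fa; apply: connected_component_refl; exact: cell_point_fixed. Qed.

(** Hence the fixed cells in S are those of a union of components. *)
Lemma component_saturated S a b : fixed_closed S -> fixed_cell a -> fixed_cell b ->
  fixed_component a = fixed_component b -> S a = S b.
Proof.
move=> cS fa fb ab.
have := @interpolate_component S a (cell_point R b) cS fa.
rewrite ab interpolate_cell_point => /(_ (fixed_component_refl fb)).
by rewrite /real_indicator => /eqP; rewrite eqr_nat; case: (S a); case: (S b).
Qed.

Lemma pred1_fixed_closed e : flipped_edge e -> fixed_closed (pred1 (inr e : cellT)).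
Proof.
move=> fe d fd /=; apply/esym/negbTE; apply: contraTneq fe => -[<-].
by rewrite (fixed_flipped fd).
Qed.

Lemma component_flipped_edge e a : flipped_edge e -> fixed_cell a ->
  fixed_component a = fixed_component (inr e) -> a = inr e.
Proof.
move=> fe fa ae; apply/eqP.
have fe' : fixed_cell (inr e : cellT) := fe.
by have := component_saturated (pred1_fixed_closed fe) fa fe' ae; rewrite /= eqxx.
Qed.

(** Every component of the fixed locus contains a fixed cell. *)
Lemma fixed_component_cell y : Fix y ->
  exists a, [/\ fixed_cell a, fixed_component a y &
    forall e, a = inr e -> y = cell_point R (inr e)].
Proof.
move=> Fy; have [[v iv yv]|[e [s [fe ->]]]|[e fe ->]] := fixed_point_cases Fy.
- exists (inl v); split=> //=; first exact/eqP.
  by rewrite /fixed_component yv; apply: connected_component_refl; rewrite /= -yv.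
- exists (inl (src e)); split=> //=; last exact: (@fixed_edge_component (e, false)).
  by have := @fixed_edge_orig _ (e, false) fe => ->.
- exists (inr e); split=> //; last by move=> e' [->].
  exact: (@fixed_component_refl (inr e)).
Qed.

(** The midpoint of a flipped edge is isolated in the fixed locus. *)
Lemma fixed_component_midpoint e y : flipped_edge e ->
  fixed_component (inr e) y -> y = cell_point R (inr e).
Proof.
move=> fe ey; have Fy := connected_component_sub ey.
have [a [fa ay aE]] := fixed_component_cell Fy.
apply: aE; apply: component_flipped_edge => //.
by rewrite /fixed_component (same_connected_component ay) (same_connected_component ey).
Qed.

Section Equivariance.
Variable f : graph_perm G.
Hypothesis af : is_graph_aut f.
Hypothesis fi : (f * i = i * f)%g.

Lemma realization_act_fixed y : Fix y -> Fix (act f y).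
Proof.
rewrite /fixed_points /= => iy.
by rewrite -realization_actM ?ai // fi realization_actM ?ai // iy.
Qed.

Lemma fixed_component_act_sub a : fixed_cell a ->
  act f @` fixed_component a `<=` fixed_component (subdivision_vertex_act f a).
Proof.
move=> fa; apply: connected_component_max.
- exists (cell_point R a); first exact: fixed_component_refl.
  exact: realization_act_cell.
- by move=> _ [y /connected_component_sub Fy <-]; exact: realization_act_fixed.
apply: connected_continuous_connected; first exact: component_connected.
apply: continuous_subspaceT; exact: realization_act_continuous.
Qed.

End Equivariance.

Lemma fixed_component_act f a : is_graph_aut f -> (f * i = i * f)%g -> fixed_cell a ->
  act f @` fixed_component a = fixed_component (subdivision_vertex_act f a).
Proof.
move=> af fi fa; apply/seteqP; split; first exact: fixed_component_act_sub.
move=> y fy; have afV := graph_autV af.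
have fiV : (f^-1 * i = i * f^-1)%g.
  by apply: (mulgI f); rewrite !mulgA mulgV mul1g fi -mulgA mulgV mulg1.
exists (act f^-1%g y); last by rewrite -realization_actM // mulVg realization_act1.
have faf : fixed_cell (subdivision_vertex_act f a) by rewrite aut_fixed_cell.
have := fixed_component_act_sub afV fiV faf.
have -> : subdivision_vertex_act f^-1%g (subdivision_vertex_act f a) = a.
  case: a {fa fy faf} => [v|e] /=; first by rewrite permK.
  by rewrite -edge_actM // mulgV /edge_act perm1.
by apply; exists y.
Qed.

End FixedLocus.

(** * Components with a point at integral distance from a vertex *)

(** A nonempty set of nonnegative reals with integral differences has a least
    element. *)
Lemma inf_discrete (R : realType) (A : set R) : A !=set0 -> (forall x, A x -> 0 <= x) ->
  (forall x y, A x -> A y -> x - y \is a Num.int) -> A (inf A).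
Proof.
move=> A0 Age Aint.
have hA : has_inf A by split=> //; exists 0.
have [x Ax xlt] := inf_adherent ltr01 hA.
have lex y : A y -> inf A <= y by apply: ge_inf; exists 0.
have [->//|nx] := eqVneq (inf A) x.
have xgt : inf A < x by rewrite lt_neqAle nx lex.
have xA : 0 < x - inf A by rewrite subr_gt0.
(* Otherwise some y of A lies between inf A and x, at distance less than 1. *)
have [y Ay ylt] := inf_adherent xA hA.
have y1 : 0 < x - y by move: (ylt); lra.
have y2 : x - y < 1 by have := lex _ Ay; lra.
have /intrP [m mE] := Aint _ _ Ax Ay.
by move: y1 y2; rewrite mE ltr0z -[1]/(1%:~R) ltr_int; case: m {mE} => [[|]|].
Qed.

Section IntegralComponents.
Variables (R : realType) (G : metric_hyperelliptic_graph R).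
Hypothesis Gint : forall e : edge G, edge_length e \is a Num.int.
Local Notation cellT := (vertex G + edge G)%type.

(** The length of an edge as an integer; it is the length itself when that is
    integral. *)
Definition int_length (e : edge G) : int := Num.floor (edge_length e).

Lemma int_lengthE e : edge_length e = (int_length e)%:~R.
Proof. by rewrite /int_length floorK. Qed.

Lemma edge_length_ge0 (e : edge G) : 0 <= edge_length e.
Proof. exact/ltW/length_gt0. Qed.

Lemma path_length_ge0 (x : realization R G) v l : path_lengths x v l -> 0 <= l.
Proof.
move=> [u [l0 [p [xu _ ->]]]]; apply: addr_ge0; last first.
  by apply: sumr_ge0 => d _; exact: edge_length_ge0.
case: xu => [[_ ->]//|[e [s [_ [[_ ->]|[_ ->]]]]]]; apply: mulr_ge0.
- exact: I01_ge0.
- exact: edge_length_ge0.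
- by rewrite subr_ge0 I01_le1.
- exact: edge_length_ge0.
Qed.

Lemma vertex_dist0 (v : vertex G) : vertex_dist (vertex_point R v) v = 0.
Proof.
apply/eqP; rewrite eq_le; apply/andP; split.
  apply: ge_inf; first by exists 0 => l; exact: path_length_ge0.
  exists v, 0, [::]; split=> //=; first by left.
  by rewrite big_nil addr0.
apply: lb_le_inf; last by move=> l; exact: path_length_ge0.
exists 0, v, 0, [::]; split=> //=; first by left.
by rewrite big_nil addr0.
Qed.

(** From the midpoint of an edge one leaves that edge after half its length. *)
Lemma midpoint_segment (e : edge G) u l :
  segment_to (cell_point R (inr e)) u l -> l = edge_length e / 2.
Proof.
have h0 : 0 < \val (midpoint R) by rewrite /= invr_gt0 ltr0n.
have h1 : \val (midpoint R) < 1 by rewrite /= invf_lt1 ?ltr0n // ltr1n.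
case=> [[/(edge_point_inj h0 h1) //]|[e' [s [/(edge_point_inj h0 h1)]]]].
move=> /cells_inr_inj [-> ->] /=.
by case=> -[_ ->]; lra.
Qed.

Lemma midpoint_dist (e : edge G) (v : vertex G) : exists m : int,
  vertex_dist (cell_point R (inr e)) v = edge_length e / 2 + m%:~R.
Proof.
set A := path_lengths (cell_point R (inr e)) v.
have AE l : A l -> exists m : int, l = edge_length e / 2 + m%:~R.
  move=> [u [l0 [p [/midpoint_segment -> _ ->]]]].
  exists (\sum_(d <- p) int_length d.1); congr (_ + _).
  by rewrite rmorph_sum; apply: eq_bigr => d _; rewrite /= int_lengthE.
apply: (AE); apply: inf_discrete.
- have [_ /(_ (src e) v) [p wp]] := hgraph_connected G.
  exists (edge_length e / 2 + \sum_(d <- p) edge_length d.1).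
  exists (src e), (edge_length e / 2), p; split=> //; right.
  exists e, (midpoint R); split=> //; left; split=> //=; lra.
- by move=> l; exact: path_length_ge0.
move=> x y /AE [m ->] /AE [n ->].
by rewrite opprD addrACA subrr add0r -rmorphB /= intr_int.
Qed.

(** Whether the component at a fixed cell contains a point of integral distance
    from a vertex: this fails only for midpoints of flipped edges of odd length. *)
Definition integral_cell (a : cellT) : bool :=
  match a with inl _ => true | inr e => (int_length e)%:~R == 0 :> 'F_2 end.

Lemma integral_comps_cell (a : cellT) : fixed_cell a ->
  integral_comps G (@fixed_component R G a) <-> integral_cell a.
Proof.
move=> fa; split.
  case: a fa => // e fe [_ [y /(fixed_component_midpoint fe) -> [v]]].
  have [m ->] := midpoint_dist e v => /intrP [n nE]; apply/eqP.
  have lE : int_length e = (n - m) *+ 2.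
    apply: (@intr_inj R); rewrite -int_lengthE rmorphMn rmorphB /= -nE; lra.
  by rewrite lE rmorphMn /= mulr2n F2_addrr.
move=> ia; split; first by exists (cell_point R a) => //; exact: cell_point_fixed.
exists (cell_point R a); first exact: fixed_component_refl.
case: a fa ia => [v|e] fa ia; first by exists v; rewrite vertex_dist0 rpred0.
exists (src e); have [m ->] := midpoint_dist e (src e).
have [n nE] := intr_F2_eq0 (eqP ia).
by rewrite int_lengthE nE rmorphMn /= -mulr_natr mulfK ?pnatr_eq0 // -rmorphD /= intr_int.
Qed.

Lemma integral_comps_fixed C : integral_comps G C ->
  exists2 a : cellT, fixed_cell a & C = @fixed_component R G a.
Proof.
move=> [[x Fx ->] _]; have [a [fa ax _]] := fixed_component_cell Fx.
by exists a => //; rewrite /fixed_component (same_connected_component ax).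
Qed.

End IntegralComponents.

(** * The rank of the homology *)

(** The kernel of an integer matrix has a basis B, with C giving coordinates. *)
Lemma int_kernel_basis (n m : nat) (A : 'M[int]_(n, m)) :
  exists k (B : 'M[int]_(k, n)) (C : 'M[int]_(n, k)),
    [/\ B *m A = 0, B *m C = 1%:M &
        forall x : 'rV_n, x *m A = 0 -> x *m C *m B = x].
Proof.
have [L Lu [U Uu [d _ AE]]] := int_Smith_normal_form A.
set D := (\matrix_(_, _) _) in AE.
(* J indexes the zero rows of the Smith normal form, S selects them. *)
pose J := [set j | row j D == 0]%SET.
pose S : 'M[int]_(#|J|, n) := \matrix_(t, j) (j == enum_val t)%:R.
have rS : forall p (X : 'M[int]_(n, p)), S *m X = \matrix_(t, j) X (enum_val t) j.
  move=> p X.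
  apply/matrixP => t j; rewrite !mxE (bigD1 (enum_val t)) //= big1 => [|h /negbTE nh].
    by rewrite mxE eqxx mul1r addr0.
  by rewrite mxE nh mul0r.
exists #|J|, (S *m invmx L), (L *m S^T); split=> [||x xA].
- rewrite AE !mulmxA mulmxKV // rS.
  rewrite (_ : matrix_of_fun _ _ = 0) ?mul0mx //; apply/matrixP => t j; rewrite [LHS]mxE.
  have := enum_valP t; rewrite inE => /eqP/rowP/(_ j).
  by rewrite [LHS]mxE => ->; rewrite !mxE.
- rewrite mulmxA mulmxKV // rS; apply/matrixP => t t'; rewrite !mxE.
  by rewrite (inj_eq enum_val_inj).
pose y := x *m L; suff yS : y *m S^T *m S = y by rewrite !mulmxA yS mulmxK.
have yDU : y *m D *m U = 0 by rewrite -xA AE !mulmxA.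
have yD : y *m D = 0 by rewrite -[LHS](mulmxK Uu) yDU mul0mx.
have y0 j : j \notin J -> y 0 j = 0.
  rewrite inE => /rV0Pn [j' jj']; move/rowP/(_ j'): yD; rewrite mxE.
  have Djj' : D j j' = d`_j *+ (j == j' :> nat) by rewrite mxE.
  have ejj' : j = j' :> nat.
    by apply/eqP; apply: contraNT jj' => /negbTE njj; rewrite mxE Djj' njj.
  rewrite (bigD1 j) //= big1 ?addr0 => [|h nh]; last first.
    by rewrite [D _ _]mxE -ejj' (inj_eq val_inj) (negbTE nh) mulr0n mulr0.
  rewrite [RHS]mxE => /eqP; rewrite mulf_eq0 => /orP[/eqP //|/eqP Dj].
  by move: jj'; rewrite [row _ _ _ _]mxE Dj eqxx.
apply/rowP => j; rewrite mxE; case: (boolP (j \in J)) => Jj.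
  rewrite (bigD1 (enum_rank_in Jj j)) //= big1 ?addr0 => [|t nt].
    rewrite !mxE enum_rankK_in // eqxx mulr1 (bigD1 j) //= big1 ?addr0 => [|h nh].
      by rewrite !mxE enum_rankK_in // eqxx mulr1.
    by rewrite [S^T _ _]mxE [S _ _]mxE enum_rankK_in // (negbTE nh) mulr0.
  rewrite [S _ _]mxE; case: eqP => [jt|]; last by rewrite mulr0.
  by move: nt; rewrite -(inj_eq enum_val_inj) enum_rankK_in // -jt eqxx.
rewrite y0 // big1 // => t _; rewrite [S _ _]mxE.
by case: eqP => [jt|]; [move: Jj; rewrite jt enum_valP | rewrite mulr0].
Qed.

Section HomologyBasis.
Variable G : graph.

(** Chains as row vectors, indexed by the enumeration of the edges. *)
Definition chain_row (c : chain G) : 'rV[int]_#|edge G| := \row_j c (enum_val j).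
Definition row_chain (x : 'rV[int]_#|edge G|) : chain G :=
  [ffun e => x 0 (enum_rank e)].

Lemma chain_rowK : cancel chain_row row_chain.
Proof. by move=> c; apply/ffunP => e; rewrite ffunE mxE enum_rankK. Qed.

Definition boundary_matrix : 'M[int]_(#|edge G|, #|vertex G|) :=
  \matrix_(j, w) ((tgt (enum_val j) == enum_val w)%:R -
                  (src (enum_val j) == enum_val w)%:R).

Lemma boundary_matrixE x w :
  (x *m boundary_matrix) 0 w = boundary (row_chain x) (enum_val w).
Proof.
rewrite mxE /boundary [X in _ = X - _]big_mkcond [X in _ = _ - X]big_mkcond -sumrB /=.
rewrite (reindex (@enum_val _ (edge G))) /=; last first.
  by apply: onW_bij; exact: enum_val_bij.
apply: eq_bigr => j _; rewrite mxE ffunE enum_valK mulrBr.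
by do 2!case: eqP => _; rewrite ?mulr1 ?mulr0.
Qed.

Lemma row_chain_cycle x :
  (row_chain x \in @is_1cycle G) = (x *m boundary_matrix == 0).
Proof.
apply/forallP/eqP => [cx|x0 v].
  by apply/rowP => w; rewrite boundary_matrixE mxE; apply/eqP.
by rewrite -[v]enum_rankK -boundary_matrixE x0 mxE.
Qed.

(** The homology is free, so that its rank is that of some basis. *)
Lemma H1_Zbasis : exists n, exists b : 'I_n -> H1 G, is_Zbasis b.
Proof.
have [k [B [C [BA BC xCB]]]] := int_kernel_basis boundary_matrix.
have bP t : row_chain (row t B) \in @is_1cycle G.
  by rewrite row_chain_cycle -row_mul BA row0.
exists k, (fun t => MkH1 (bP t)).
have sE (a : {ffun 'I_k -> int}) :
    chain_row (\sum_(t < k) MkH1 (bP t) *~ a t : H1 G) = (\row_t a t) *m B.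
  apply/rowP => j; rewrite !mxE.
  have -> : H1_chain (\sum_(t < k) MkH1 (bP t) *~ a t) (enum_val j) =
      \sum_(t < k) H1_chain (MkH1 (bP t) *~ a t) (enum_val j).
    by apply: (big_morph (fun x : H1 G => H1_chain x (enum_val j))) => [x y|]; rewrite ffunE.
  apply: eq_bigr => t _; rewrite mxE.
  have -> : H1_chain (MkH1 (bP t) *~ a t) (enum_val j) =
      H1_chain (MkH1 (bP t)) (enum_val j) *~ a t.
    pose ev (x : H1 G) : int := H1_chain x (enum_val j).
    have evB : zmod_morphism ev by move=> x y; rewrite /ev !ffunE.
    pose evm := GRing.isZmodMorphism.Build _ _ ev evB.
    pose evA : {additive H1 G -> int} := HB.pack ev evm.
    exact: (raddfMz evA).
  by rewrite /= ffunE enum_valK mxE mulrzz mulrC.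
exists (fun x : H1 G => [ffun t => (chain_row x *m C) 0 t]) => [a|x].
  by apply/ffunP => t; rewrite ffunE sE -mulmxA BC mulmx1 mxE.
apply: val_inj; apply: (can_inj chain_rowK); rewrite sE.
rewrite (_ : \row_t _ = chain_row x *m C); last by apply/rowP => t; rewrite mxE ffunE.
by rewrite xCB //; apply/eqP; rewrite -row_chain_cycle chain_rowK (valP x).
Qed.

Lemma Zrank_H1 : exists b : 'I_(Zrank (H1 G)) -> H1 G, is_Zbasis b.
Proof.
have [n nb] := H1_Zbasis.
rewrite /Zrank; case: xgetP => [m -> //|/(_ n)]; exact.
Qed.

End HomologyBasis.

(** A free abelian group of rank n has 2^n elements modulo two; D is any map whose
    fibres are the classes modulo two. *)
Lemma Zbasis_card2 (M : zmodType) (n : nat) (b : 'I_n -> M) (V : finType) (D : M -> V) :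
    is_Zbasis b -> (forall x y, D x = D y <-> exists z, x - y = z *+ 2) ->
  #|[set v | `[< exists x, D x = v >]]%SET| = (2 ^ n)%N.
Proof.
move=> [co bK coK] DE; pose F (a : {ffun 'I_n -> int}) := \sum_(j < n) b j *~ a j.
have FB a a' : F a - F a' = F (a - a').
  by rewrite /F -sumrB; apply: eq_bigr => j _; rewrite !ffunE mulrzBr.
have F2 a : F (a + a) = F a *+ 2.
  by rewrite /F -sumrMnl; apply: eq_bigr => j _; rewrite ffunE mulrzDr mulr2n.
(* Coordinates modulo two, and their representatives 0 and 1. *)
pose lift (a : {ffun 'I_n -> 'F_2}) : {ffun 'I_n -> int} := [ffun j => (val (a j))%:Z].
pose red (a : {ffun 'I_n -> int}) : {ffun 'I_n -> 'F_2} := [ffun j => (a j)%:~R].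
have liftK : cancel lift red.
  by move=> a; apply/ffunP => j; rewrite !ffunE; case: (F2_cases (a j)) => ->.
have DF a a' : D (F a) = D (F a') <-> red a = red a'.
  split=> [/DE [z zE]|rE].
    have : F (a - a') = F (co z + co z) by rewrite F2 -FB zE /F coK.
    move=> /(can_inj bK) aE; apply/ffunP => j; move/ffunP/(_ j): aE.
    rewrite !ffunE => aj; apply/eqP; rewrite -subr_eq0 -rmorphB /= aj rmorphD.
    by rewrite F2_addrr.
  apply/DE; have h j : exists z, a j - a' j = z *+ 2.
    apply: intr_F2_eq0; rewrite rmorphB /=; move/ffunP/(_ j): rE.
    by rewrite !ffunE => ->; rewrite subrr.
  have [z zE] := choice h; exists (F [ffun j => z j]).
  by rewrite FB -F2; congr F; apply/ffunP => j; rewrite !ffunE zE mulr2n.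
rewrite -[in RHS](card_Fp (isT : prime 2)) -[n in RHS]card_ord -card_ffun.
rewrite -(card_imset _ (_ : injective (fun a => D (F (lift a))))); last first.
  by move=> a a' /DF; rewrite !liftK.
apply: eq_card => v; rewrite inE; apply/asboolP/imsetP => [[x <-]|[a _ ->]];
  last by exists (F (lift a)).
exists (red (co x)) => //; rewrite -[x in LHS]coK; apply/DF.
by rewrite liftK.
Qed.

(** The number of functions to F_2 supported in a nonempty set and of sum 0. *)
Lemma card_sum0 (T : finType) (P : {set T}) (p0 : T) : p0 \in P ->
  #|[set f : {ffun T -> 'F_2} | (f \in pffun_on 0 P predT) &&
                                (\sum_(p in P) f p == 0)]%SET|
  = (2 ^ #|P|.-1)%N.
Proof.
move=> Pp0; have -> : (#|P|.-1 = #|P :\ p0|)%SET by rewrite (cardsD1 p0) Pp0.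
rewrite -[in RHS](card_Fp (isT : prime 2)) -(card_pffun_on 0 (mem (P :\ p0)%SET) predT).
(* The value at p0 is determined by the values at the other points of P. *)
pose ext (g : {ffun T -> 'F_2}) : {ffun T -> 'F_2} :=
  [ffun p => if p == p0 then \sum_(q in P) g q else g p].
have g0 (g : {ffun T -> 'F_2}) : g \in pffun_on 0 (mem (P :\ p0)%SET) predT -> g p0 = 0.
  move=> /pffun_onP[/fintype.subsetP sg _]; apply/eqP; apply: contraT => gp.
  by have := sg p0 gp; rewrite !inE eqxx.
rewrite -(card_in_imset (_ : {in pffun_on 0 (mem (P :\ p0)%SET) predT &,
                             injective ext})); last first.
  move=> g g' gP gP' /ffunP E; apply/ffunP => p; have := E p; rewrite !ffunE.
  by case: eqP => [->|//]; rewrite !g0.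
apply: eq_card => f; rewrite inE.
apply/andP/imsetP => [[/pffun_onP[/fintype.subsetP sf _] /eqP f0]|].
  exists [ffun p => if p == p0 then 0 else f p].
    apply/pffun_onP; split=> //; apply/fintype.subsetP => p; rewrite !inE ffunE.
    by have [->|np] := eqVneq p p0; [rewrite eqxx | exact: sf].
  apply/ffunP => p; rewrite ffunE.
  case: eqP => [->|/eqP np]; last by rewrite ffunE (negbTE np).
  rewrite [RHS](bigD1 p0) //= ffunE eqxx add0r.
  move/eqP: f0; rewrite (bigD1 p0) //= addr_eq0 F2_oppr => /eqP ->.
  by apply: eq_bigr => q /andP[_ /negbTE nq]; rewrite ffunE nq.
move=> [g gP ->]; have /pffun_onP[/fintype.subsetP sg _] := gP; split.
  apply/pffun_onP; split=> //; apply/fintype.subsetP => p; rewrite inE ffunE.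
  by have [-> //|np gp] := eqVneq p p0; have := sg p gp; rewrite !inE => /andP[].
rewrite (bigD1 p0) //= ffunE eqxx (bigD1 p0) //= g0 // add0r.
rewrite -big_split /= big1 // => q /andP[_ /negbTE nq].
by rewrite ffunE nq F2_addrr.
Qed.

(** * The 2-torsion of the Tamagawa group *)

Section TamagawaTorsion.
Variables (R : realType) (G : metric_hyperelliptic_graph R).
Hypothesis Gint : forall e : edge G, edge_length e \is a Num.int.
Local Notation cellT := (vertex G + edge G)%type.
Local Notation i := (Defs.iota G).
Local Notation Tam := (Tamagawa G).
Local Notation L := (@int_length R G).

(** The class of a functional in the Tamagawa group. *)
Definition tamagawa_class (phi : H1dual G) : Tam :=
  \pi_{ideal_quot (@in_H1_image R G)} phi.

Lemma tamagawa_classD phi psi :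
  tamagawa_class (phi + psi) = tamagawa_class phi + tamagawa_class psi.
Proof. exact: Quotient.pi_add. Qed.

Lemma tamagawa_classN phi : tamagawa_class (- phi) = - tamagawa_class phi.
Proof. exact: Quotient.pi_opp. Qed.

Lemma tamagawa_class_eq phi psi :
  tamagawa_class phi = tamagawa_class psi <-> phi - psi \in @in_H1_image R G.
Proof. by rewrite Quotient.idealrBE; split=> /eqP. Qed.

Lemma tamagawa_class_eq0 phi : tamagawa_class phi = 0 <-> phi \in @in_H1_image R G.
Proof.
have -> : (0 : Tam) = tamagawa_class 0.
  by apply: (addrI (tamagawa_class 0)); rewrite addr0 -tamagawa_classD addr0.
by rewrite tamagawa_class_eq subr0.
Qed.

(** The pairing, with integral values. *)
Definition int_pairing (c c' : chain G) : int := \sum_e L e * c e * c' e.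

Lemma pairingE c c' : pairing c c' = (int_pairing c c')%:~R.
Proof.
rewrite rmorph_sum; apply: eq_bigr => e _ /=.
by rewrite int_lengthE // !rmorphM.
Qed.

Lemma int_pairingDl c1 c2 c :
  int_pairing (c1 + c2) c = int_pairing c1 c + int_pairing c2 c.
Proof.
by rewrite -big_split; apply: eq_bigr => e _; rewrite /= ffunE mulrDr mulrDl.
Qed.

Lemma int_pairingDr c c1 c2 :
  int_pairing c (c1 + c2) = int_pairing c c1 + int_pairing c c2.
Proof.
by rewrite -big_split; apply: eq_bigr => e _; rewrite /= ffunE mulrDr.
Qed.

Lemma int_pairingNl c1 c : int_pairing (- c1) c = - int_pairing c1 c.
Proof.
by rewrite -sumrN; apply: eq_bigr => e _; rewrite /= ffunE mulrN mulNr.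
Qed.

Lemma int_length_gt0 e : 0 < L e.
Proof. by rewrite -(ltr0z R) -int_lengthE // length_gt0. Qed.

(** The pairing is definite. *)
Lemma int_pairing_def c : int_pairing c c = 0 -> c = 0.
Proof.
have ge0 e : 0 <= L e * c e * c e.
  by rewrite -mulrA mulr_ge0 ?(ltW (int_length_gt0 e)) // -expr2 sqr_ge0.
move=> /eqP; rewrite psumr_eq0 // => /allP c0; apply/ffunP => e.
have := c0 e (mem_index_enum e); rewrite /= -mulrA mulf_eq0 gt_eqF ?int_length_gt0 //=.
by rewrite mulf_eq0 orbb ffunE => /eqP.
Qed.

Lemma int_pairing_inj (x y : H1 G) :
  (forall z : H1 G, int_pairing x z = int_pairing y z) -> x = y.
Proof.
move=> xy; apply/eqP; rewrite -subr_eq0; apply/eqP/val_inj.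
by apply: int_pairing_def; rewrite int_pairingDl int_pairingNl xy subrr.
Qed.

Lemma in_H1_imageP (phi : H1dual G) :
  phi \in @in_H1_image R G <-> exists z : H1 G, forall y, phi y = int_pairing z y.
Proof.
split=> [/asboolP[z zE]|[z zE]]; last apply/asboolP; exists z => y.
  by apply: (@intr_inj R); rewrite zE pairingE.
by rewrite pairingE zE.
Qed.

Lemma H1dualD (phi psi : H1dual G) x : (phi + psi) x = phi x + psi x.
Proof. by []. Qed.

Lemma H1dualN (phi : H1dual G) x : (- phi) x = - phi x.
Proof. by []. Qed.

(** A cycle x halves to the class u if u is represented by <x, - > / 2.  This
    relates 2-torsion classes to the cycles in the radical of the pairing modulo
    two, determined up to 2 H. *)
Definition halves_to (x : H1 G) (u : Tam) : Prop :=
  exists2 phi : H1dual G, u = tamagawa_class phi &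
    forall y : H1 G, phi y *+ 2 = int_pairing x y.

Lemma halves_to_exists u : Tamagawa2 G u -> exists x, halves_to x u.
Proof.
rewrite /Tamagawa2 /= -[u]reprK -/(tamagawa_class _) mulr2n -tamagawa_classD.
move=> /tamagawa_class_eq0/in_H1_imageP [x xE].
by exists x, (repr u).
Qed.

Lemma halves_to_torsion x u : halves_to x u -> Tamagawa2 G u.
Proof.
move=> [phi -> phiE]; rewrite /Tamagawa2 /= mulr2n -tamagawa_classD.
by apply/tamagawa_class_eq0/in_H1_imageP; exists x => y; rewrite H1dualD -mulr2n.
Qed.

Lemma halves_toD x y u v : halves_to x u -> halves_to y v -> halves_to (x + y) (u + v).
Proof.
move=> [phi -> phiE] [psi -> psiE]; exists (phi + psi); first by rewrite tamagawa_classD.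
by move=> z; rewrite H1dualD mulrnDl phiE psiE int_pairingDl.
Qed.

Lemma halves_toN x u : halves_to x u -> halves_to (- x) (- u).
Proof.
move=> [phi -> phiE]; exists (- phi); first by rewrite tamagawa_classN.
by move=> z; rewrite H1dualN mulNrn phiE int_pairingNl.
Qed.

Lemma halves_to0 x u : halves_to x u -> u = 0 <-> exists z, x = z *+ 2.
Proof.
move=> [phi -> phiE]; rewrite tamagawa_class_eq0 in_H1_imageP.
split=> -[z zE]; exists z.
  by apply: int_pairing_inj => y; rewrite -phiE zE !mulr2n int_pairingDl.
move=> y; apply/eqP; rewrite -(eqr_pMn2r (isT : (0 < 2)%N)) phiE zE.
by rewrite !mulr2n int_pairingDl.
Qed.

Lemma halves_to_eq x y u v : halves_to x u -> halves_to y v ->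
  u = v <-> exists z, x - y = z *+ 2.
Proof.
move=> xu yv; rewrite -(halves_to0 (halves_toD xu (halves_toN yv))).
by split=> [->|/eqP]; [rewrite subrr | rewrite subr_eq0 => /eqP].
Qed.

Lemma halves_to_even x u (y : H1 G) : halves_to x u -> (int_pairing x y)%:~R = 0 :> 'F_2.
Proof. by move=> [phi _ <-]; rewrite mulr2n rmorphD /= F2_addrr. Qed.

Lemma even_halves_to (x : H1 G) :
  (forall y : H1 G, (int_pairing x y)%:~R = 0 :> 'F_2) -> exists u, halves_to x u.
Proof.
move=> ev; have [h hE] := choice (fun y => intr_F2_eq0 (ev y)).
have hf : h \in @is_functional G.
  apply/asboolP => y z; apply/eqP; rewrite -(eqr_pMn2r (isT : (0 < 2)%N)).
  by rewrite mulrnDl -!hE int_pairingDr.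
by exists (tamagawa_class (MkH1dual hf)), (MkH1dual hf).
Qed.

(** * Equivariance of the pairing and of halving *)

Lemma hAut_props (g : hAut G) : [/\ is_graph_aut (sgval g),
  forall e, L (edge_act (sgval g) e) = L e & (sgval g * i = i * sgval g)%g].
Proof.
have := subgP g; rewrite inE => /and4P[ag _ /forallP lg /eqP gi]; split=> // e.
by rewrite /int_length (eqP (lg e)).
Qed.

Lemma int_pairing_act (f : graph_perm G) (c c' : chain G) : is_graph_aut f ->
    (forall e, L (edge_act f e) = L e) ->
  int_pairing (chain_act f c) c' = int_pairing c (chain_act f^-1%g c').
Proof.
move=> af lf; have inj : injective (edge_act f).
  by move=> e e' ee; have /(_ (inr e) (inr e')) := subdivision_vertex_act_inj af;
     rewrite /= ee => /(_ erefl) [].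
rewrite /int_pairing (reindex_inj inj) /=; apply: eq_bigr => e _.
rewrite lf -!mulrA; congr (_ * _).
have cE (c1 c2 : chain G) (d : dart G) :
  c1 d.1 * c2 d.1 = dart_coef c1 d * dart_coef c2 d.
  by rewrite /dart_coef mulrACA -expr2 sqrr_sign mul1r.
rewrite -[edge_act f e]/((f.2 (e, false)).1) cE dart_coef_act // permK.
rewrite -[e in RHS]/((e, false).1) [RHS]cE; congr (_ * _).
by rewrite dart_coef_act ?graph_autV // invgK.
Qed.

(** The term z accounts for the canonical representative of u, by which the
    action is defined: it may differ from the half of <x, - > by some <z, - >. *)
Lemma halves_to_act (g : hAut G) x u : halves_to x u -> exists z : H1 G,
  halves_to (H1_act (hAut_graph_aut g) (x + z *+ 2)) (Tamagawa_act G g u).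
Proof.
move=> [phi uE phiE]; have [ag lg _] := hAut_props g.
have /tamagawa_class_eq/in_H1_imageP[z zE] : tamagawa_class (repr u) = tamagawa_class phi.
  by rewrite -uE; exact: reprK.
exists z, (H1dual_act g (repr u)) => // y.
rewrite /= int_pairing_act //.
rewrite -[chain_act _ y]/(H1_chain (H1_act (hAut_graph_aut g^-1%g) y)).
set y' := H1_act _ y; have /eqP := zE y'; rewrite H1dualD H1dualN subr_eq => /eqP ->.
by rewrite mulrnDl phiE !mulr2n !int_pairingDl addrC.
Qed.

(** * The boundary of a cycle on the components of the fixed locus *)

Local Notation comp := (@fixed_component R G).

(** The cells whose component is C.  Only fixed cells matter here. *)
Definition in_component (C : set (realization R G)) : pred cellT :=
  fun a => `[< comp a = C >].

(** The boundary modulo two of a chain at a component of the fixed locus; it is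
    zero at every other set of points. *)
Definition component_boundary (c : chain G) (C : set (realization R G)) : 'F_2 :=
  part_boundary c (in_component C).

Lemma component_boundaryD c c' C :
  component_boundary (c + c') C = component_boundary c C + component_boundary c' C.
Proof. exact: part_boundaryD. Qed.

Lemma component_boundary_sum (I : finType) (A : pred I) (F : I -> H1 G) C :
  component_boundary (\sum_(j | A j) F j : H1 G) C =
  \sum_(j | A j) component_boundary (F j) C.
Proof.
apply: (big_morph (fun x : H1 G => component_boundary x C)) => [x y|].
  exact: component_boundaryD.
rewrite /component_boundary /part_boundary big1 // => -[v|e] _ /=.
  by rewrite big1 // => d _; rewrite /mod2 ffunE.
by rewrite /mod2 ffunE.
Qed.

(** A fixed cell chosen in the component of a given fixed cell; the default value
    is never used at a fixed cell. *)
Definition component_rep (a : cellT) : cellT :=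
  odflt a [pick b | fixed_cell b && in_component (comp a) b].

(** One fixed cell in each component of the fixed locus. *)
Definition component_reps : {set cellT} :=
  [set a | fixed_cell a && (component_rep a == a)]%SET.

Local Notation P := component_reps.

Lemma component_repP a : fixed_cell a ->
  fixed_cell (component_rep a) /\ comp (component_rep a) = comp a.
Proof.
move=> fa; rewrite /component_rep; case: pickP => [b /andP[fb /asboolP //]|/(_ a)] //=.
Qed.

Lemma component_rep_eq a b : fixed_cell a -> comp a = comp b ->
  component_rep a = component_rep b.
Proof.
move=> fa ab; rewrite /component_rep -ab.
by case: pickP => [//|/(_ a)]; rewrite fa /= => /asboolP.
Qed.

Lemma component_rep_in a : fixed_cell a -> component_rep a \in P.
Proof.
move=> fa; have [fr rr] := component_repP fa.
by rewrite inE fr /= (component_rep_eq fr rr).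
Qed.

Lemma component_reps_fixed p : p \in P -> fixed_cell p.
Proof. by rewrite inE => /andP[]. Qed.

Lemma component_reps_inj p q : p \in P -> q \in P -> comp p = comp q -> p = q.
Proof.
rewrite !inE => /andP[fp /eqP rp] /andP[fq /eqP rq] pq.
by rewrite -rp -rq (component_rep_eq fp pq).
Qed.

Lemma in_component_reps p q : p \in P -> q \in P -> in_component (comp q) p = (p == q).
Proof.
move=> Pp Pq; apply/asboolP/eqP => [|-> //]; exact: component_reps_inj.
Qed.

Lemma part_boundary_components c (S : pred cellT) :
    (forall a b, fixed_cell a -> fixed_cell b -> comp a = comp b -> S a = S b) ->
  part_boundary c S = \sum_(p in P | S p) component_boundary c (comp p).
Proof.
move=> sS; rewrite /part_boundary.
rewrite (partition_big component_rep (fun p => (p \in P) && S p)) /=; last first.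
  move=> a /andP[fa Sa]; rewrite component_rep_in //=.
  by have [fr rr] := component_repP fa; rewrite (sS _ a).
apply: eq_bigr => p /andP[Pp Sp]; apply: eq_bigl => a.
have [fa|//] := boolP (fixed_cell a) => /=.
have [fp /eqP rp] : fixed_cell p /\ component_rep p == p.
  by move: Pp; rewrite inE => /andP[].
apply/andP/asboolP => [[Sa /eqP <-]|ap]; first by have [_ ->] := component_repP fa.
by rewrite (sS a p) // (component_rep_eq fa ap) rp.
Qed.

(** The boundary of a cycle has sum zero. *)
Lemma component_boundary_total (x : H1 G) :
  \sum_(p in P) component_boundary x (comp p) = 0.
Proof.
rewrite -[RHS](part_boundary_total (valP x)) (part_boundary_components x (S := predT)) //.
by apply: eq_bigl => p; rewrite andbT.
Qed.

(** A cycle with zero boundary on the tree is divisible by two. *)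
Lemma component_boundary_eq0 (x : H1 G) :
    (forall p, p \in P -> component_boundary x (comp p) = 0) ->
  exists z : H1 G, x = z *+ 2.
Proof.
move=> x0; have [e|c' cc' xE] := cycle_halve (valP x).
  apply/eqP; apply: contraT => ne; have [S cS] := odd_edge_cut (valP x) ne.
  rewrite part_boundary_components => [|a b fa fb]; last exact: component_saturated.
  by rewrite big1 => [ne0|p /andP[/x0]]; first by rewrite -ne0 eqxx in ne.
exists (MkH1 cc'); apply: val_inj; rewrite /= xE !mulr2n.
by [].
Qed.

(** Every function of sum zero is the boundary of a cycle: add up cycles joining
    the points of its support to a base point p0. *)
Lemma cycle_with_boundary (a : cellT -> 'F_2) : \sum_(p in P) a p = 0 ->
  exists x : H1 G, forall p, p \in P -> component_boundary x (comp p) = a p.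
Proof.
move=> a0; have [P0|[p0 Pp0]] := set_0Vmem P.
  by exists 0 => p; rewrite P0 inE.
have h p : exists x : H1 G, p \in P -> forall q, q \in P ->
    component_boundary x (comp q) = (p == q)%:R + (p0 == q)%:R.
  case: (boolP (p \in P)) => [Pp|_]; last by exists 0.
  have [c cc cE] := cycle_between (component_reps_fixed Pp) (component_reps_fixed Pp0).
  exists (MkH1 cc) => _ q Pq; rewrite /component_boundary cE.
    by rewrite !in_component_reps.
  by move=> d fd; rewrite /in_component fixed_component_edge.
have [x xE] := choice h.
exists (\sum_(p in P) (if a p == 0 then 0 else x p)) => q Pq.
rewrite component_boundary_sum.
transitivity (\sum_(p in P) (a p * (p == q)%:R + a p * (p0 == q)%:R)).
  apply: eq_bigr => p Pp; case: eqP => [->|/eqP ap].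
    rewrite !mul0r addr0 /component_boundary /part_boundary big1 // => -[v|e] _ /=.
      by rewrite big1 // => d _; rewrite /mod2 ffunE.
    by rewrite /mod2 ffunE.
  rewrite xE //; have [ap0|->] := F2_cases (a p); last by rewrite !mul1r.
  by rewrite ap0 eqxx in ap.
rewrite big_split /= -mulr_suml a0 mul0r addr0 (bigD1 q) //= eqxx mulr1 big1 ?addr0 //.
by move=> p /andP[_ /negbTE ->]; rewrite mulr0.
Qed.

(** Modulo two the pairing of two cycles is the sum, over the midpoints of
    flipped edges of odd length, of the products of their boundaries. *)
Lemma int_pairing_mod2 (x y : H1 G) : (int_pairing x y)%:~R =
  \sum_(p in P | ~~ integral_cell p)
    component_boundary x (comp p) * component_boundary y (comp p).
Proof.
have flip_comp e : flipped_edge e -> forall b, fixed_cell b ->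
    comp b = comp (inr e : cellT) -> b = inr e.
  by move=> fe b fb; exact: component_flipped_edge.
have cb (z : H1 G) e : flipped_edge e ->
    component_boundary z (comp (inr e : cellT)) = mod2 z e.
  move=> fe; rewrite /component_boundary /part_boundary.
  rewrite (bigD1 (inr e : cellT)) /=; last first.
    by rewrite /= fe /=; apply/asboolP.
  rewrite big1 ?addr0 // => b /andP[/andP[fb /asboolP bE]].
  by rewrite (flip_comp _ fe b fb bE) eqxx.
have Pe e : (inr e \in P) = flipped_edge e.
  apply/idP/idP => [/component_reps_fixed //|fe].
  have [fr rr] := @component_repP (inr e) fe.
  rewrite inE /= fe /=; apply/eqP; exact: flip_comp.
rewrite sum_cells [X in _ = X + _]big1 ?add0r => [|v]; last by rewrite andbF.
transitivity (\sum_e (L e)%:~R * mod2 x e * mod2 y e : 'F_2).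
  by rewrite rmorph_sum; apply: eq_bigr => e _; rewrite /= !rmorphM.
rewrite sum_flipped_edges ?(valP x) ?(valP y) //; last first.
  by move=> e; rewrite /int_length length_iota.
rewrite (bigID (fun e => (L e)%:~R == 0 :> 'F_2)) /= big1 ?add0r; last first.
  by move=> e /andP[_ /eqP ->]; rewrite !mul0r.
apply: eq_big => e; first by rewrite Pe.
move=> /andP[fe Le]; rewrite !cb //.
by have [L0|->] := F2_cases (L e)%:~R; [rewrite L0 eqxx in Le | rewrite mul1r].
Qed.

(** The boundary is equivariant. *)
Lemma component_boundary_act (g : hAut G) (x : H1 G) C :
  component_boundary (H1_act (hAut_graph_aut g) x) C =
  component_boundary x (realization_act (sgval g^-1%g) @` C).
Proof.
have [ag _ gi] := hAut_props g; set f := sgval g in ag gi *.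
have fK : cancel (subdivision_vertex_act f) (subdivision_vertex_act f^-1%g).
  case=> [v|e] /=; first by rewrite permK.
  by rewrite -edge_actM ?graph_autV // mulgV /edge_act perm1.
have inj : injective (subdivision_vertex_act f) := can_inj fK.
rewrite /component_boundary /part_boundary (reindex_inj inj) /=; apply: eq_big => a.
  rewrite aut_fixed_cell //; have [fa|//] := boolP (fixed_cell a) => /=.
  have aK (y : realization R G) : realization_act f^-1%g (realization_act f y) = y.
    by rewrite -realization_actM ?graph_autV // mulgV realization_act1.
  have aVK (y : realization R G) : realization_act f (realization_act f^-1%g y) = y.
    by rewrite -realization_actM ?graph_autV // mulVg realization_act1.
  rewrite /in_component -fixed_component_act //; apply/asboolP/asboolP.
    move=> <-; apply/seteqP; split=> [y ay|_ [_ [z az <-] <-]].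
      by exists (realization_act f y); [exists y | exact: aK].
    by rewrite aK.
  move=> ->; apply/seteqP; split=> [_ [_ [z Cz <-] <-]|y Cy].
    by rewrite aVK.
  by exists (realization_act f^-1%g y); [exists y | exact: aVK].
by move=> /andP[fa _]; rewrite cell_boundary_act ?(valP x) // -(aut_fixed_cell ag).
Qed.

Lemma component_boundary_double (x z : H1 G) C :
  component_boundary (x + z *+ 2 : H1 G) C = component_boundary x C.
Proof. by rewrite mulr2n component_boundaryD component_boundaryD F2_addrr addr0. Qed.

Lemma component_boundary_reps (x y : H1 G) :
    (forall p, p \in P ->
       component_boundary x (comp p) = component_boundary y (comp p)) ->
  exists z : H1 G, x - y = z *+ 2.
Proof.
move=> xy; apply: component_boundary_eq0 => p Pp.
have -> : x - y = x + y - y *+ 2 by rewrite mulr2n opprD addrA addrK.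
by rewrite -mulNrn component_boundary_double component_boundaryD xy // F2_addrr.
Qed.

(** * The rank in terms of the number of components *)

(** The boundary as an element of a finite type; its fibres are the classes modulo
    two. *)
Definition boundary_vector (x : H1 G) : {ffun cellT -> 'F_2} :=
  [ffun p => if p \in P then component_boundary x (comp p) else 0].

Lemma boundary_vector_eq x y :
  boundary_vector x = boundary_vector y <-> exists z : H1 G, x - y = z *+ 2.
Proof.
split=> [/ffunP xy|[z /eqP]].
  by apply: component_boundary_reps => p Pp; have := xy p; rewrite !ffunE Pp.
rewrite subr_eq addrC => /eqP ->; apply/ffunP => p; rewrite !ffunE.
by rewrite component_boundary_double.
Qed.

Lemma Zrank_components : P != finset.set0 -> Zrank (H1 G) = #|P|.-1.
Proof.
move=> /set0Pn [p0 Pp0]; have [b bb] := Zrank_H1 G.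
apply/eqP; rewrite -(@eqn_exp2l 2) // -(Zbasis_card2 bb boundary_vector_eq).
rewrite -(card_sum0 Pp0); apply/eqP/eq_card => f; rewrite !inE.
apply/asboolP/andP => [[x <-]|[/pffun_onP[/fintype.subsetP sf _] /eqP f0]].
  split; last first.
    rewrite -[X in _ == X](component_boundary_total x); apply/eqP.
    by apply: eq_bigr => p Pp; rewrite ffunE Pp.
  apply/pffun_onP; split=> //; apply/fintype.subsetP => p.
  by rewrite inE ffunE; case: ifP => // _; rewrite eqxx.
have [x xE] := cycle_with_boundary f0; exists x; apply/ffunP => p; rewrite ffunE.
case: ifP => [/xE //|/negbT Pp]; apply/esym/eqP; apply: contraNT Pp => fp.
exact: sf.
Qed.

Lemma Zrank_no_components : P = finset.set0 -> Zrank (H1 G) = 0%N.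
Proof.
move=> P0; have [b bb] := Zrank_H1 G; apply/eqP; rewrite -(@eqn_exp2l 2) //.
rewrite -(Zbasis_card2 bb boundary_vector_eq) expn0.
apply/cards1P; exists 0; apply/setP => f; rewrite !inE.
apply/asboolP/eqP => [[x <-]|->].
  by apply/ffunP => p; rewrite !ffunE P0 inE.
by exists 0; apply/ffunP => p; rewrite !ffunE P0 inE.
Qed.

(** * The three cases *)

(** A cycle halving to a given 2-torsion class; the default value 0 is never used
    at such a class. *)
Definition half_of (u : Tam) : H1 G := xget 0 [set x | halves_to x u].

Lemma half_ofP u : Tamagawa2 G u -> halves_to (half_of u) u.
Proof.
by move=> /halves_to_exists [x xu]; rewrite /half_of; case: xgetP => [y -> //|/(_ x)].
Qed.

Lemma half_of_eq u v : Tamagawa2 G u -> Tamagawa2 G v ->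
    (forall p, p \in P -> component_boundary (half_of u) (comp p) =
                          component_boundary (half_of v) (comp p)) -> u = v.
Proof.
move=> /half_ofP uu /half_ofP vv /component_boundary_reps.
by move/(halves_to_eq uu vv).
Qed.

Lemma half_of_boundary x u C : halves_to x u ->
  component_boundary (half_of u) C = component_boundary x C.
Proof.
move=> xu; have uu := half_ofP (halves_to_torsion xu).
have [/(_ erefl) [z zE] _] := halves_to_eq uu xu.
by move/eqP: zE; rewrite subr_eq addrC => /eqP ->; rewrite component_boundary_double.
Qed.

Lemma half_ofD u v C : Tamagawa2 G u -> Tamagawa2 G v ->
  component_boundary (half_of (u + v)) C =
  component_boundary (half_of u) C + component_boundary (half_of v) C.
Proof.
move=> /half_ofP uu /half_ofP vv; rewrite -component_boundaryD.
exact: half_of_boundary (halves_toD uu vv).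
Qed.

Lemma half_of_act g u C : Tamagawa2 G u ->
  component_boundary (half_of (Tamagawa_act G g u)) C =
  component_boundary (half_of u) (realization_act (sgval g^-1%g) @` C).
Proof.
move=> /half_ofP /(halves_to_act g) [z zE].
by rewrite (half_of_boundary _ zE) component_boundary_act component_boundary_double.
Qed.

Lemma half_of_pairing u (y : H1 G) : Tamagawa2 G u ->
  \sum_(p in P | ~~ integral_cell p)
    component_boundary (half_of u) (comp p) * component_boundary y (comp p) = 0.
Proof. by move=> /half_ofP /(halves_to_even y); rewrite int_pairing_mod2. Qed.

(** The coordinates outside W of a class in the radical are all equal, and equal
    to zero as soon as W is nonempty: pair it with a cycle joining two
    components. *)
Lemma half_of_compare u p q : Tamagawa2 G u -> p \in P -> q \in P ->
  (if integral_cell p then 0 else component_boundary (half_of u) (comp p)) =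
  (if integral_cell q then 0 else component_boundary (half_of u) (comp q)).
Proof.
move=> tu Pp Pq; pose a r : 'F_2 := (r == p)%:R + (r == q)%:R.
have sa (h : cellT -> 'F_2) (A : pred cellT) : \sum_(r in P | A r) h r * a r =
    (if A p then h p else 0) + (if A q then h q else 0).
  have one r : r \in P -> \sum_(s in P | A s) h s * (s == r)%:R = if A r then h r else 0.
    move=> Pr; rewrite big_mkcondr (bigD1 r) //= eqxx mulr1 big1 ?addr0 //.
    by move=> s /andP[_ /negbTE ->]; rewrite mulr0 if_same.
  by under eq_bigr do rewrite mulrDr; rewrite big_split /= !one.
have [|y yE] := @cycle_with_boundary a.
  have s1 := sa (fun=> 1) predT; rewrite /= F2_addrr in s1; rewrite -[RHS]s1.
  by apply: eq_big => [r|r _]; rewrite ?andbT ?mul1r.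
have := half_of_pairing y tu.
under eq_bigr => r /andP[Pr _] do rewrite yE //.
rewrite (sa (fun r => component_boundary (half_of u) (comp r)) (fun r => ~~ integral_cell r)).
by move=> /eqP; rewrite addr_eq0 F2_oppr !if_neg => /eqP.
Qed.

Lemma integral_comps_rep p : p \in P -> integral_comps G (comp p) <-> integral_cell p.
Proof. by move=> Pp; apply: integral_comps_cell => //; exact: component_reps_fixed. Qed.

Lemma integral_comps_repP C : integral_comps G C ->
  exists p, [/\ p \in P, integral_cell p & C = comp p].
Proof.
move=> WC; have [a fa CE] := integral_comps_fixed WC.
have [fr rr] := component_repP fa; exists (component_rep a); split.
- exact: component_rep_in.
- by apply/(integral_comps_rep (component_rep_in fa)); rewrite rr -CE.
- by rewrite rr.
Qed.

Lemma component_boundary_support c C : component_boundary c C != 0 ->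
  exists2 p, p \in P & C = comp p.
Proof.
move=> cC.
have [a /andP[fa /asboolP aC]|none] :=
  pickP (fun a => fixed_cell a && in_component C a).
  exists (component_rep a); first exact: component_rep_in.
  by have [_ ->] := component_repP fa.
by move: cC; rewrite /component_boundary /part_boundary big_pred0 // eqxx.
Qed.

Section NoIntegralComponent.
Hypothesis W0 : integral_comps G = set0.

Lemma no_integral_cell p : p \in P -> integral_cell p = false.
Proof.
move=> Pp; apply/negP => /(integral_comps_rep Pp).
by rewrite W0.
Qed.

Lemma half_of_const u p q : Tamagawa2 G u -> p \in P -> q \in P ->
  component_boundary (half_of u) (comp p) = component_boundary (half_of u) (comp q).
Proof.
by move=> tu Pp Pq; have := half_of_compare tu Pp Pq; rewrite !no_integral_cell.
Qed.

Lemma sum_const (t : 'F_2) : \sum_(p in P) t = if odd #|P| then t else 0.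
Proof.
rewrite sumr_const -[in LHS](odd_double_half #|P|) mulrnDr -muln2 mulnC mulrnA mulr2n.
by rewrite F2_addrr mul0rn addr0; case: odd.
Qed.

(** With W empty, the boundaries of the classes in the radical are the constant
    functions of sum zero on the components; the rank decides whether these
    include the function 1. *)
Lemma tamagawa2_even : ~~ odd (Zrank (H1 G)) ->
  module_iso (Tamagawa2 G) (Tamagawa_act G)
    ([set 0] : set 'F_2) (@trivial_act (hAut G) 'F_2).
Proof.
move=> rk; exists (fun=> 0); split=> [|x y _ _|g x _]; rewrite ?addr0 //.
have zero u : Tamagawa2 G u -> forall p, p \in P ->
    component_boundary (half_of u) (comp p) = 0.
  move=> tu p Pp; have P0 : P != finset.set0 by apply/set0Pn; exists p.
  have odP : odd #|P|.
    by move: rk; rewrite Zrank_components //; move: P0; rewrite -card_gt0; case: #|P|.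
  rewrite -[RHS](component_boundary_total (half_of u)).
  rewrite (eq_bigr (fun=> component_boundary (half_of u) (comp p))) ?sum_const ?odP //.
  by move=> q Pq; exact: half_of_const.
split=> [u _ //|u v|y ->]; first last.
  by exists 0 => //; rewrite /Tamagawa2 /= mul0rn.
rewrite !inE => tu tv _; apply: half_of_eq => // p Pp.
by rewrite !zero.
Qed.

Lemma tamagawa2_odd : odd (Zrank (H1 G)) ->
  module_iso (Tamagawa2 G) (Tamagawa_act G)
    ([set: 'F_2]) (@trivial_act (hAut G) 'F_2).
Proof.
move=> rk; have [P0|[p0 Pp0]] := set_0Vmem P; first by rewrite Zrank_no_components in rk.
have evP : odd #|P| = false.
  apply/negbTE; move: rk; rewrite Zrank_components; last by apply/set0Pn; exists p0.
  have : (0 < #|P|)%N by apply/card_gt0P; exists p0.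
  by case: #|P| => //= n _; rewrite negbK.
exists (fun u => component_boundary (half_of u) (comp p0)); split.
- split=> [u //|u v|t _].
    rewrite !inE => tu tv uv; apply: half_of_eq => // p Pp.
    by rewrite (half_of_const tu Pp Pp0) uv (half_of_const tv Pp0 Pp).
  have [|x xE] := @cycle_with_boundary (fun=> t); first by rewrite sum_const evP.
  have [|u xu] := @even_halves_to x.
    move=> y; rewrite int_pairing_mod2.
    under eq_bigr => p /andP[Pp _] do rewrite xE //.
    rewrite -mulr_sumr (eq_bigl (fun p => p \in P)).
      by rewrite component_boundary_total mulr0.
    by move=> p; case: (boolP (p \in P)) => //= Pp; rewrite no_integral_cell.
  exists u; first exact: halves_to_torsion xu.
  by rewrite (half_of_boundary _ xu) xE.
- by move=> u v; rewrite !inE => tu tv; exact: half_ofD.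
move=> g u; rewrite inE => tu; rewrite half_of_act // /trivial_act.
have [ag _ gi] := hAut_props g^-1%g.
have fp := component_reps_fixed Pp0.
rewrite fixed_component_act //; have := aut_fixed_cell ag gi p0; rewrite fp => fgp.
have [_ <-] := component_repP fgp.
by apply: half_of_const => //; exact: component_rep_in.
Qed.

End NoIntegralComponent.

(** The sum over W, indexed by fixed cells. *)
Lemma F2W_sum_reps (a : F2_fun G) :
  F2W_sum a = \sum_(p in P | integral_cell p) a (comp p).
Proof.
have WE : integral_comps G = comp @` [set` [pred p | (p \in P) && integral_cell p]].
  apply/seteqP; split=> [C /integral_comps_repP [p [Pp ip ->]]|_ [p /andP[Pp ip] <-]].
    by exists p => //=; rewrite inE Pp.
  exact/(integral_comps_rep Pp).
rewrite /F2W_sum WE fsbig_image; last first.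
  move=> p q; rewrite !inE => /andP[Pp _] /andP[Pq _]; exact: component_reps_inj.
apply/esym/bigfs; first exact: index_enum_uniq.
by move=> p _; rewrite mem_index_enum.
Qed.

Lemma finite_reps (A : set cellT) : finite_set A.
Proof. exact: finite_finset. Qed.

Lemma tamagawa2_integral : integral_comps G <> set0 ->
  module_iso (Tamagawa2 G) (Tamagawa_act G) (F2W_sum_ker G) (F2_fun_act G).
Proof.
move=> /eqP/set0P [C0 /integral_comps_repP [p0 [Pp0 ip0 _]]].
have nonint u p : Tamagawa2 G u -> p \in P -> ~~ integral_cell p ->
    component_boundary (half_of u) (comp p) = 0.
  by move=> tu Pp /negbTE ip; have := half_of_compare tu Pp Pp0; rewrite ip ip0.
exists (fun u => component_boundary (half_of u) : F2_fun G); split.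
- split=> [u tu|u v|a [[fa sa] a0]].
  + have supp : [set C | component_boundary (half_of u) C != 0] `<=` integral_comps G.
      move=> C /= ne; have [p Pp CE] := component_boundary_support ne.
      rewrite CE; apply/(integral_comps_rep Pp); apply: contraT => ip.
      by rewrite CE nonint // eqxx in ne.
    split; first split=> //.
      apply: (@sub_finite_set _ _ (comp @` [set: cellT])).
        by move=> C /supp /integral_comps_repP [p [_ _ ->]]; exists p.
      by apply: finite_image; exact: finite_reps.
    rewrite /= F2W_sum_reps -[RHS](component_boundary_total (half_of u)).
    rewrite [RHS](bigID (@integral_cell R G)) /= [X in _ = _ + X]big1 ?addr0 //.
    by move=> p /andP[Pp ip]; exact: nonint.
  + rewrite !inE => tu tv uv; apply: half_of_eq => // p Pp.
    by rewrite uv.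
  have a_supp C : ~ integral_comps G C -> a C = 0.
    by move=> nW; apply/eqP; apply: contra_notT nW => aC; exact: sa.
  have sa0 : \sum_(p in P) a (comp p) = 0.
    rewrite (bigID (@integral_cell R G)) /= -F2W_sum_reps (a0 : F2W_sum a = 0) add0r.
    rewrite big1 // => p /andP[Pp ip]; apply: a_supp.
    by move=> /(integral_comps_rep Pp); apply/negP.
  have [x xE] := cycle_with_boundary sa0.
  have [|u xu] := @even_halves_to x.
    move=> y; rewrite int_pairing_mod2 big1 // => p /andP[Pp ip].
    rewrite xE // a_supp ?mul0r // => /(integral_comps_rep Pp).
    by apply/negP.
  exists u; first exact: halves_to_torsion xu.
  apply/funext => C; rewrite (half_of_boundary _ xu).
  have [[p [Pp CE]]|nC] := pselect (exists p, p \in P /\ C = comp p).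
    by rewrite CE xE.
  rewrite a_supp => [|/integral_comps_repP [p [Pp _ CE]]]; last by apply: nC; exists p.
  apply/eqP; apply: contra_notT nC => /component_boundary_support [p Pp CE].
  by exists p.
- move=> u v; rewrite !inE => tu tv; apply/funext => C; exact: half_ofD.
by move=> g u; rewrite inE => tu; apply/funext => C; exact: half_of_act.
Qed.

End TamagawaTorsion.

Theorem corollary1p4 (R : realType) (G : metric_hyperelliptic_graph R)
    (hG : integral_hyperelliptic G) :
  [/\ integral_comps G = set0 -> ~~ odd (Zrank (H1 G)) ->
        module_iso (Tamagawa2 G) (Tamagawa_act G)
          ([set 0] : set 'F_2) (@trivial_act (hAut G) 'F_2),
      integral_comps G = set0 -> odd (Zrank (H1 G)) ->
        module_iso (Tamagawa2 G) (Tamagawa_act G)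
          ([set: 'F_2]) (@trivial_act (hAut G) 'F_2) &
      integral_comps G <> set0 ->
        module_iso (Tamagawa2 G) (Tamagawa_act G)
          (F2W_sum_ker G) (F2_fun_act G)].
Proof.
have [_ Gint] := hG; split=> [W0 rk|W0 rk|W0].
- exact: tamagawa2_even.
- exact: tamagawa2_odd.
exact: tamagawa2_integral.
Qed.
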